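(* Let $\Theta$ be an $N$-tuple of pairwise commuting symmetric positive definite $n\times n$ matrices. If $Y$ is $\Theta$-self-similar, then $\mathcal{M}_\Theta Y\in\mathcal{G}_{\Theta,0}$. If $G\in\mathcal{G}_\Theta$, then $\mathcal{M}^{-1}_\Theta G$ is $\Theta$-self-similar. Moreover $(\mathcal{M}^{-1}_\Theta\circ\mathcal{M}_\Theta)(Y)=Y$ for every $\Theta$-self-similar $Y$ and $(\mathcal{M}_\Theta\circ\mathcal{M}^{-1}_\Theta)(G)=G$ for every $G\in\mathcal{G}_{\Theta,0}$.
   Context: For $t\in\mathbb{Z}^N$ and an $N$-tuple $\Theta$ of $n\times n$ matrices, $t\ast\Theta=\sum_{j=1}^N t_j\Theta_j$. For a field $Z=(Z_t)_{t\in\mathbb{Z}^N}$, $\Delta_t Z=\sum_{i\in\{0,1\}^N}(-1)^{i_1+\dots+i_N}Z_{t_1-i_1,\dots,t_N-i_N}$; for a field $Y=(Y_{e^t})_{t\in\mathbb{Z}^N}$, $\Delta_tY=\sum_{i\in\{0,1\}^N}(-1)^{i_1+\dots+i_N}Y_{e^{t-i}}$. Equality in law of fields means equality of all finite-dimensional distributions. $Y$ is $\Theta$-self-similar if $(Y_{e^{t+s}})_{t}$ and $(e^{s\ast\Theta}Y_{e^t})_{t}$ are equal in law for every $s\in\mathbb{Z}^N$. $G$ is a stationary increment field if $(\Delta_{t+s}G)_{t}$ and $(\Delta_tG)_{t}$ are equal in law for every $s$. $\mathcal{G}_\Theta$ is the class of stationary increment fields $G$ such that $\sum_{j=-\infty}^te^{j\ast\Theta}\Delta_jG:=\lim_{M_1\to\infty}\cdots\lim_{M_N\to\infty}\sum_{j_1=-M_1}^{t_1}\cdots\sum_{j_N=-M_N}^{t_N}e^{j\ast\Theta}\Delta_jG$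 converges in probability for every $t\in\mathbb{Z}^N$; $\mathcal{G}_{\Theta,0}$ is the subclass with $G_t=0$ a.s. whenever $t_l=0$ for some $l$. The transformations are: $(\mathcal{M}^{-1}_\Theta G)_{e^t}=\sum_{j=-\infty}^te^{j\ast\Theta}\Delta_jG$, and $(\mathcal{M}_\Theta Y)_t=(-1)^{|\{l:t_l<0\}|}\sum_j e^{-j\ast\Theta}\Delta_jY$, where the sum runs over $j\in\mathbb{Z}^N$ with $1\le j_l\le t_l$ if $t_l\ge0$ and $t_l+1\le j_l\le0$ if $t_l<0$ (empty ranges give empty sums). *)

(* Defs.v *)
From HB Require Import structures.
From mathcomp Require Import all_boot all_order all_algebra.
From mathcomp Require Import all_classical all_reals all_analysis.
Set Implicit Arguments.
Unset Strict Implicit.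
Unset Printing Implicit Defensive.
Import Order.TTheory GRing.Theory Num.Theory.
Import numFieldNormedType.Exports.
Local Open Scope classical_set_scope.
Local Open Scope ring_scope.

Section Defs.
Context {R : realType}.

Definition mexp (n : nat) (A : 'M[R]_n) : 'M[R]_n :=
  \matrix_(i, j) lim ((fun K : nat => \sum_(k < K) (A ^+ k) i j / (k`!)%:R) @ \oo).

Definition tstar (N n : nat) (t : 'I_N -> int) (Theta : 'I_N -> 'M[R]_n) : 'M[R]_n :=
  \sum_(j < N) (t j)%:~R *: Theta j.

Definition symmetric_mx (n : nat) (A : 'M[R]_n) := A^T = A.
Definition posdef_mx (n : nat) (A : 'M[R]_n) :=
  forall v : 'cV[R]_n, v != 0 -> 0 < (v^T *m A *m v) 0 0.

Definition addt (N : nat) (t s : 'I_N -> int) : 'I_N -> int := fun l => t l + s l.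

(* finite sum over the box { j in Z^N | lo_l <= j_l <= hi_l for all l }
   (empty if some hi_l < lo_l); j is written j = lo + d with 0 <= d_l < W *)
Definition box_sum (V : zmodType) (N : nat) (lo hi : 'I_N -> int)
    (F : ('I_N -> int) -> V) : V :=
  \sum_(d : {ffun 'I_N -> 'I_(\max_(l < N) `|hi l - lo l|%N).+1}
          | [forall l, lo l + (d l)%:Z <= hi l])
     F (fun l => lo l + (d l)%:Z).

Context {d : measure_display} {T : measurableType d} (P : probability T R).

Definition rvec (n : nat) := T -> 'cV[R]_n.

Definition rvec_meas (n : nat) (X : rvec n) :=
  forall i : 'I_n, measurable_fun setT (fun w => X w i 0).

Definition field (N n : nat) := ('I_N -> int) -> rvec n.

Definition is_field (N n : nat) (X : field N n) := forall t, rvec_meas (X t).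

Definition Delta (N n : nat) (Z : field N n) (t : 'I_N -> int) : rvec n :=
  fun w => \sum_(b : {ffun 'I_N -> bool})
      (-1) ^+ (\sum_(l < N) (b l : nat)) *: Z (fun l => t l - (b l : nat)%:Z) w.

(* generators of the Borel sigma-algebra of (R^n)^k = R^(k n) (cylinders) *)
Definition fdd_cyl (k n : nat) : set (set ('I_k -> 'I_n -> R)) :=
  fun B => exists (i : 'I_k) (j : 'I_n) (A : set R),
      measurable A /\ B = [set x | A (x i j)].

Definition eq_fdd (N n : nat) (X Y : field N n) :=
  forall (ts : seq ('I_N -> int)) (B : set ('I_(size ts) -> 'I_n -> R)),
    <<s (@fdd_cyl (size ts) n) >> B ->
    P [set w | B (fun i j => X (nth (fun=> 0) ts i) w j 0)] =
    P [set w | B (fun i j => Y (nth (fun=> 0) ts i) w j 0)].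

(* Theta-self-similarity; the field Y_{e^t} is represented by t |-> Y t *)
Definition self_similar (N n : nat) (Theta : 'I_N -> 'M[R]_n) (Y : field N n) :=
  is_field Y /\
  forall s : 'I_N -> int,
    eq_fdd (fun t => Y (addt t s))
           (fun t w => mexp (tstar s Theta) *m Y t w).

Definition stationary_increments (N n : nat) (G : field N n) :=
  forall s : 'I_N -> int,
    eq_fdd (fun t => Delta G (addt t s)) (fun t => Delta G t).

Definition cvg_prob (n : nat) (Xs : nat -> rvec n) (X : rvec n) :=
  rvec_meas X /\
  forall eps : R, 0 < eps ->
    (fun m => P [set w | eps < `|Xs m w - X w| ]) @ \oo --> 0%E.

Fixpoint cvg_iter (n k : nat) (F : seq nat -> rvec n) (L : rvec n) : Prop :=
  match k with
  | 0 => F [::] = L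
  | k.+1 => exists Gs : nat -> rvec n,
      (forall M : nat, cvg_iter k (fun ms => F (M :: ms)) (Gs M)) /\ cvg_prob Gs L
  end.

Definition Minv_partial (N n : nat) (Theta : 'I_N -> 'M[R]_n) (G : field N n)
    (t : 'I_N -> int) (ms : seq nat) : rvec n :=
  fun w => box_sum (fun l => - (nth 0%N ms l)%:Z) t
                   (fun j => mexp (tstar j Theta) *m Delta G j w).

Definition Minv_converges (N n : nat) (Theta : 'I_N -> 'M[R]_n) (G : field N n)
    (t : 'I_N -> int) :=
  exists L : rvec n, cvg_iter N (Minv_partial Theta G t) L.

Definition GTheta (N n : nat) (Theta : 'I_N -> 'M[R]_n) (G : field N n) :=
  is_field G /\ stationary_increments G /\ forall t, Minv_converges Theta G t.

Definition GTheta0 (N n : nat) (Theta : 'I_N -> 'M[R]_n) (G : field N n) :=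
  GTheta Theta G /\
  forall t : 'I_N -> int, (exists l, t l = 0) -> {ae P, forall w, G t w = 0}.

(* (M^{-1}_Theta G)_{e^t} : the (a.s. unique) iterated limit in probability;
   an arbitrary value (0) is used when the limit does not exist *)
Definition Minv (N n : nat) (Theta : 'I_N -> 'M[R]_n) (G : field N n) : field N n :=
  fun t => match pselect (Minv_converges Theta G t) with
           | left h => projT1 (cid h)
           | right _ => fun _ => 0
           end.

Definition Mtheta (N n : nat) (Theta : 'I_N -> 'M[R]_n) (Y : field N n) : field N n :=
  fun t w =>
    (-1) ^+ #|[set l : 'I_N | t l < 0]| *:
    box_sum (fun l => if 0 <= t l then 1 else t l + 1)
            (fun l => if 0 <= t l then t l else 0)
            (fun j => mexp (- tstar j Theta) *m Delta Y j w).

End Defs.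

(* Main.v *)
(** Taking increments of [Mtheta Y] gives [e^{-t*Theta} Delta_t Y], and
    [e^{s*Theta} e^{-(t+s)*Theta} = e^{-t*Theta}] turns self-similarity of [Y]
    into stationarity of these increments.  The partial sums defining
    [Minv (Mtheta Y)] telescope to an alternating sum of [Y] over the corners of
    a box; a corner with a coordinate going to minus infinity has the law of
    [e^{-m Theta_k}] applied to a fixed vector, which tends to 0 in probability
    because [Theta_k] is positive definite.  So only [Y_t] survives.  Conversely,
    the partial sums for [Minv G] at [t + s] with lower bounds [-M] have the same
    law as [e^{s*Theta}] times the partial sums at [t] with lower bounds [-(M+s)],
    and both converge; while the increments of [Minv G] are
    [e^{t*Theta} Delta_t G] almost surely, so that [Mtheta] telescopes back to the
    corners of [G], all but one of which vanish when [G] is null on the axes. *)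
Require Import Defs.
From HB Require Import structures.
From mathcomp Require Import all_boot all_order all_algebra.
From mathcomp Require Import all_classical all_reals all_analysis.
From mathcomp Require Import measurable_realfun zify ring lra.
Set Implicit Arguments.
Unset Strict Implicit.
Unset Printing Implicit Defensive.
Import Order.TTheory GRing.Theory Num.Theory.
Import numFieldNormedType.Exports.
Local Open Scope classical_set_scope.
Local Open Scope ring_scope.

(** * Box sums as tensor products of signed measures on Z *)

(** The identities are N-dimensional, but their signs, ranges and increments factor over the
    coordinates. [tensor_sum] exploits this: it integrates [Z] against the product over l of the
    signed measures on Z that put mass [a l y] at [p l y]. Box sums, increments and their
    compositions are then compared one coordinate at a time, by case analysis on integers. The
    limits are the other obstacle: an iterated limit in probability is not a limit along one given
    sequence. Only an iterated eventual closeness is kept from each limit ([iev]); finitely many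
    such properties share a tuple of lower bounds, and at that tuple two finite sums are compared
    exactly, pointwise or in law. Laws are tested on lower orthants, where a small error in
    probability becomes a slack in the bounds, removed by continuity from above. *)

Definition tensor_sum (K : comNzRingType) (V : lmodType K) (N : nat) (A : finType)
    (a : 'I_N -> A -> K) (p : 'I_N -> A -> int) (Z : ('I_N -> int) -> V) : V :=
  \sum_(f : {ffun 'I_N -> A}) (\prod_l a l (f l)) *: Z (fun l => p l (f l)).

Lemma prod_nat_bool (K : comNzRingType) (I : finType) (b : I -> bool) :
  \prod_i (b i)%:R = ([forall i, b i] : bool)%:R :> K.
Proof.
case: (boolP [forall i, b i]) => [/forallP h|].
  by rewrite big1 // => i _; rewrite h.
by rewrite negb_forall => /existsP[i bi]; rewrite (bigD1 i) //= (negbTE bi) mul0r.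
Qed.

(** Enumerates the integers of [-m, m] by a finite type. *)
Definition centered (m : nat) (x : 'I_(m + m).+1) : int := (x : nat)%:Z - m%:Z.

Lemma centered_surj m (y : int) : (absz y <= m)%N -> exists x : 'I_(m + m).+1, centered x = y.
Proof.
move=> ym; have h : (absz (y + m%:Z)%R < (m + m).+1)%N by lia.
by exists (Ordinal h); rewrite /centered /=; lia.
Qed.

Lemma centered_inj m : injective (@centered m).
Proof. by move=> x y; rewrite /centered => h; apply: val_inj => /=; lia. Qed.

(** Pushing every factor forward to [-m, m]: expanding the product of the one-dimensional masses
    leaves, for each f, the single window point with coordinates [p l (f l)]. *)
Lemma tensor_sum_window (K : comNzRingType) (V : lmodType K) (N : nat) (A : finType) m
    (a : 'I_N -> A -> K) (p : 'I_N -> A -> int) (Z : ('I_N -> int) -> V) :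
  (forall l x, (absz (p l x) <= m)%N) ->
  tensor_sum a p Z =
  \sum_(x : {ffun 'I_N -> 'I_(m + m).+1})
     (\prod_l \sum_(y : A) a l y * (p l y == centered (x l))%:R) *: Z (fun l => centered (x l)).
Proof.
move=> pm; under [RHS]eq_bigr => x _ do rewrite bigA_distr_bigA scaler_suml.
rewrite exchange_big /=; apply: eq_bigr => f _.
have [x0 x0E] : exists x : {ffun 'I_N -> 'I_(m + m).+1}, forall l, centered (x l) = p l (f l).
  have /fin_all_exists[x xE] : forall l : 'I_N, exists x : 'I_(m + m).+1, centered x = p l (f l).
    by move=> l; apply: centered_surj.
  by exists (finfun x) => l; rewrite ffunE.
rewrite (bigD1 x0) //= [X in _ + X]big1 ?addr0; last first.
  move=> x xx0; rewrite big_split /= prod_nat_bool.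
  case: (boolP [forall _, _]) => [/forallP h|]; last by rewrite mulr0 scale0r.
  case/eqP: xx0; apply/ffunP => l; apply: (@centered_inj m).
  by rewrite x0E; apply/esym/eqP/h.
rewrite big_split /= prod_nat_bool.
have -> : [forall i, p i (f i) == centered (x0 i)] by apply/forallP => l; rewrite x0E.
rewrite mulr1; congr (_ *: Z _); by apply: funext => l; rewrite x0E.
Qed.

(* A tensor product of finitely supported signed measures on Z depends on its
   one-dimensional factors only, not on the way they are presented. *)
Lemma tensor_sum_ext (K : comNzRingType) (V : lmodType K) (N : nat) (A B : finType)
    (a : 'I_N -> A -> K) (p : 'I_N -> A -> int)
    (b : 'I_N -> B -> K) (q : 'I_N -> B -> int) (Z : ('I_N -> int) -> V) :
  (forall l (x : int), \sum_y a l y * (p l y == x)%:R = \sum_y b l y * (q l y == x)%:R) ->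
  tensor_sum a p Z = tensor_sum b q Z.
Proof.
move=> h; pose m := (\max_l \max_y absz (p l y) + \max_l \max_y absz (q l y))%N.
rewrite (@tensor_sum_window _ _ _ _ m) ?(@tensor_sum_window _ _ _ _ m).
- by apply: eq_bigr => x _; congr (_ *: _); apply: eq_bigr => l _.
- move=> l x; apply: leq_trans (leq_addl _ _).
  apply: leq_trans (leq_bigmax_cond (F := fun l => \max_y absz (q l y)) l isT).
  exact: (leq_bigmax_cond (F := fun y => absz (q l y))).
- move=> l x; apply: leq_trans (leq_addr _ _).
  apply: leq_trans (leq_bigmax_cond (F := fun l => \max_y absz (p l y)) l isT).
  exact: (leq_bigmax_cond (F := fun y => absz (p l y))).
Qed.

(** Factor l of the inner sum depends on t only through [t l], so composing the kernels coordinate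
    by coordinate gives a tensor product again. *)
Lemma tensor_sum_comp (K : comNzRingType) (V : lmodType K) (N : nat) (A B : finType)
    (a : 'I_N -> A -> K) (p : 'I_N -> A -> int)
    (b : 'I_N -> int -> B -> K) (q : 'I_N -> int -> B -> int) (Z : ('I_N -> int) -> V) :
  tensor_sum a p (fun t => tensor_sum (fun l => b l (t l)) (fun l => q l (t l)) Z) =
  tensor_sum (fun l (z : A * B) => a l z.1 * b l (p l z.1) z.2)
       (fun l z => q l (p l z.1) z.2) Z.
Proof.
rewrite /tensor_sum; under eq_bigr => f _ do rewrite scaler_sumr.
rewrite pair_big /=.
pose h (f : {ffun 'I_N -> A * B}) :=
  ([ffun l => (f l).1] : {ffun 'I_N -> A}, [ffun l => (f l).2] : {ffun 'I_N -> B}).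
rewrite (reindex h) /=; last first.
  exists (fun fg : {ffun 'I_N -> A} * {ffun 'I_N -> B} => [ffun l => (fg.1 l, fg.2 l)])
    => [f|[f g]] _.
    by apply/ffunP => l; rewrite !ffunE -surjective_pairing.
  by congr (_, _); apply/ffunP => l; rewrite !ffunE.
apply: eq_bigr => f _; rewrite scalerA -big_split /=.
congr (_ *: Z _).
  by apply: eq_bigr => l _; rewrite !ffunE.
by apply: funext => l; rewrite !ffunE.
Qed.

Lemma indicator_itv_sum (K : comNzRingType) (W : nat) (lo hi x : int) : (absz (hi - lo)%R <= W)%N ->
  \sum_(y < W.+1) (lo + (y : nat)%:Z <= hi)%R%:R * (lo + (y : nat)%:Z == x)%:R
  = ((lo <= x) && (x <= hi))%R%:R :> K.
Proof.
move=> hW; case: (boolP ((lo <= x) && (x <= hi))) => [/andP[lx xh]|nh].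
  have yP : (absz (x - lo)%R < W.+1)%N by lia.
  rewrite (bigD1 (Ordinal yP)) //= big1 ?addr0.
    have -> : lo + `|x - lo|%N%:Z = x by lia.
    by rewrite xh eqxx mulr1.
  move=> y yx; case: eqP => [e|_]; last by rewrite mulr0.
  by case/eqP: yx; apply: val_inj => /=; lia.
rewrite big1 // => y _; case: eqP => [e|_]; last by rewrite mulr0.
case: (boolP (_ <= hi)) => [h|_]; last by rewrite mul0r.
by case/negP: nh; apply/andP; split; lia.
Qed.

(** The width of the box occurs in an index type; the existential hides its value and keeps the only
    bound that matters. *)
Lemma box_sum_tensor (K : comNzRingType) (V : lmodType K) (N : nat) (lo hi : 'I_N -> int)
    (F : ('I_N -> int) -> V) :
  exists W : nat, (forall l, (absz (hi l - lo l)%R <= W)%N) /\ box_sum lo hi F =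
  tensor_sum (fun l (y : 'I_W.+1) => (lo l + (y : nat)%:Z <= hi l)%R%:R)
       (fun l y => lo l + (y : nat)%:Z) F.
Proof.
exists (\max_(l < N) absz (hi l - lo l)%R)%N; split.
  by move=> l; exact: (leq_bigmax_cond (F := fun l => absz (hi l - lo l))).
rewrite /box_sum /tensor_sum big_mkcond /=; apply: eq_bigr => f _.
by rewrite prod_nat_bool; case: ifP; rewrite ?scale1r ?scale0r.
Qed.

Lemma box_sumP (K : comNzRingType) (V : lmodType K) (N : nat) (lo hi : 'I_N -> int)
    (A : finType) (a : 'I_N -> A -> K) (p : 'I_N -> A -> int) (F : ('I_N -> int) -> V) :
  (forall l (x : int), \sum_y a l y * (p l y == x)%:R = ((lo l <= x) && (x <= hi l))%R%:R) ->
  box_sum lo hi F = tensor_sum a p F.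
Proof.
move=> h; have [W [hW ->]] := box_sum_tensor lo hi F.
by apply: tensor_sum_ext => l x; rewrite h; apply: indicator_itv_sum.
Qed.

Definition bsgn (K : comNzRingType) (b : bool) : K := (-1) ^+ b.

(** In one coordinate, the masses +1 at x and -1 at x - 1 summed over lo <= x <= hi leave +1 at hi
    and -1 at lo - 1. For lo = hi + 1 both sides vanish; for larger lo the right side would not. *)
Lemma box_sum_telescope (K : comNzRingType) (V : lmodType K) (N : nat)
    (lo hi : 'I_N -> int) (Z : ('I_N -> int) -> V) :
  (forall l, lo l <= hi l + 1) ->
  box_sum lo hi (fun t => tensor_sum (fun l => @bsgn K) (fun l b => t l - (b : nat)%:Z) Z) =
  tensor_sum (fun l => @bsgn K) (fun l (b : bool) => if b then lo l - 1 else hi l) Z.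
Proof.
move=> h; have [W [hW ->]] := box_sum_tensor lo hi
  (fun t => tensor_sum (fun l => @bsgn K) (fun l (b : bool) => t l - (b : nat)%:Z) Z).
rewrite (tensor_sum_comp _ _ (fun l _ => @bsgn K) (fun l x (b : bool) => x - (b : nat)%:Z)).
apply: tensor_sum_ext => l x /=.
rewrite -(pair_big xpredT xpredT (fun y b => (lo l + Posz (nat_of_ord y) <= hi l)%R%:R * bsgn K b *
   (lo l + Posz (nat_of_ord y) - (nat_of_bool b)%:Z == x)%:R)) /=.
rewrite exchange_big /= !big_bool /bsgn /= !expr0 !expr1.
under eq_bigr => y _ do rewrite mulrAC subr_eq.
under [X in _ + X]eq_bigr => y _ do rewrite mulrAC subr_eq.
rewrite -!mulr_suml !indicator_itv_sum //.
have := h l; case: (boolP (lo l <= x + 1)); case: (boolP (x + 1 <= hi l));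
  case: (boolP (lo l <= x + 0)); case: (boolP (x + 0 <= hi l)); case: eqP; case: eqP => /=;
  rewrite ?mul0r ?mulr0 ?add0r ?addr0 ?mulr1 ?mul1r ?addNr ?addrN //; lia.
Qed.

(** A one-dimensional kernel whose increment at [t l] is the unit mass at [t l] is inverted by
    [Delta]. It serves for cumulative boxes and for the oriented boxes of [Mtheta]. *)
Lemma tensor_sum_Delta (K : comNzRingType) (V : lmodType K) (N : nat) (A : finType)
    (b : 'I_N -> int -> A -> K) (q : 'I_N -> int -> A -> int) t (F : ('I_N -> int) -> V) :
  (forall l (x : int), \sum_y b l (t l) y * (q l (t l) y == x)%:R
             - \sum_y b l (t l - 1) y * (q l (t l - 1) y == x)%:R = (t l == x)%:R) ->
  tensor_sum (fun l => @bsgn K) (fun l (b : bool) => t l - (b : nat)%:Z)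
    (fun s => tensor_sum (fun l => b l (s l)) (fun l => q l (s l)) F) = F t.
Proof.
move=> h; rewrite tensor_sum_comp.
(* Evaluation at t is the product of the unit masses at [t l], indexed by a one-point type. *)
transitivity (tensor_sum (fun l (_ : unit) => 1 : K) (fun l _ => t l) F); last first.
  rewrite /tensor_sum (big_pred1 [ffun=> tt]) ?big1 ?scale1r // => f.
  by apply/esym/eqP/ffunP => l; case: (f l); rewrite ffunE.
apply: tensor_sum_ext => l x; rewrite (big_pred1 tt); last by case.
rewrite mul1r -h -(pair_big xpredT xpredT (fun (c : bool) y => bsgn K c * b l (t l - (nat_of_bool c)%:Z) y *
   (q l (t l - (nat_of_bool c)%:Z) y == x)%:R)) /= big_bool /= subr0 /bsgn /= expr0 expr1 addrC.
congr (_ + _); first by apply: eq_bigr => y _; rewrite mul1r.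
by rewrite -sumrN; apply: eq_bigr => y _; rewrite mulN1r mulNr.
Qed.

(** * Matrix exponential *)

Section Mexp.
Context {R : realType}.

Lemma cvg_sumr (I : finType) (f : I -> nat -> R) (l : I -> R) :
  (forall i, f i @ \oo --> l i) -> (fun m => \sum_i f i m) @ \oo --> \sum_i l i.
Proof. by move=> h; apply: cvg_big => //; exact: add_continuous. Qed.

(** A bound on the operator norm for the sup norm. It is submultiplicative and 1 bounds the
    identity, so the entries of [A ^+ k] are at most [a ^+ k]. *)
Definition rowbnd (n : nat) (A : 'M[R]_n) (a : R) :=
  0 <= a /\ forall p, \sum_q `|A p q| <= a.

Lemma rowbnd_ex n (A : 'M[R]_n) : exists a, rowbnd A a.
Proof.
exists (\sum_p \sum_q `|A p q|); split; first by do 2 apply: sumr_ge0 => ? _.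
move=> p; rewrite [leRHS](bigD1 p) //= lerDl; apply: sumr_ge0 => i _.
exact: sumr_ge0.
Qed.

Lemma rowbnd1 n : rowbnd (1%:M : 'M[R]_n) 1.
Proof.
split=> // p; rewrite (bigD1 p) //= mxE eqxx normr1 big1 ?addr0 // => q qp.
by rewrite mxE eq_sym (negbTE qp) normr0.
Qed.

Lemma rowbndM n (A B : 'M[R]_n) a b : rowbnd A a -> rowbnd B b -> rowbnd (A *m B) (a * b).
Proof.
move=> [a0 ha] [b0 hb]; split; first exact: mulr_ge0.
move=> p; apply: (@le_trans _ _ (\sum_k `|A p k| * b)); last first.
  by rewrite -mulr_suml ler_wpM2r.
apply: (@le_trans _ _ (\sum_q \sum_k `|A p k| * `|B k q|)).
  apply: ler_sum => q _; rewrite mxE; apply: le_trans (ler_norm_sum _ _ _) _.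
  by apply: ler_sum => k _; rewrite normrM.
rewrite exchange_big /=; apply: ler_sum => k _.
by rewrite -mulr_sumr ler_wpM2l.
Qed.

Lemma rowbndX n (A : 'M[R]_n) a k : rowbnd A a -> rowbnd (A ^+ k) (a ^+ k).
Proof.
move=> h; elim: k => [|k IH]; first by rewrite !expr0; exact: rowbnd1.
by rewrite !exprS; apply: rowbndM.
Qed.

Lemma rowbnd_entry n (A : 'M[R]_n) a p q : rowbnd A a -> `|A p q| <= a.
Proof.
move=> [_ h]; apply: le_trans (h p); rewrite (bigD1 q) //= lerDl; exact: sumr_ge0.
Qed.

Definition expS (n : nat) (A : 'M[R]_n) (K : nat) : 'M[R]_n :=
  \sum_(k < K) (k`!)%:R^-1 *: A ^+ k.

Lemma expSE n (A : 'M[R]_n) K i j :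
  expS A K i j = \sum_(k < K) (A ^+ k) i j / (k`!)%:R.
Proof. by rewrite /expS summxE; apply: eq_bigr => k _; rewrite mxE mulrC. Qed.

Lemma expS_cvg n (A : 'M[R]_n) i j : (fun K => expS A K i j) @ \oo --> mexp A i j.
Proof.
have [a ha] := rowbnd_ex A.
rewrite /mexp mxE; under eq_fun do rewrite expSE.
pose u := fun k : nat => (A ^+ k) i j / (k`!)%:R.
have -> : (fun K : nat => \sum_(k < K) (A ^+ k) i j / (k`!)%:R) = series u.
  by apply: funext => K; rewrite /series /= big_mkord.
suff : cvgn (series u) by [].
apply: normed_cvg; apply: (@series_le_cvg R _ (exp_coeff a)).
- by move=> k; exact: normr_ge0.
- by move=> k; apply: exp_coeff_ge0; case: ha.
- move=> k; rewrite /u /exp_coeff /= normrM normfV normr_nat.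
  by rewrite ler_wpM2r ?invr_ge0 ?ler0n //; apply/rowbnd_entry/rowbndX.
- exact: is_cvg_series_exp_coeff.
Qed.

Lemma mexp_lim n (A : 'M[R]_n) i j (l : R) :
  (fun K => expS A K i j) @ \oo --> l -> mexp A i j = l.
Proof. by move=> h; apply: (cvg_unique _ (@expS_cvg _ A i j)). Qed.

Lemma mexp0 n : mexp (0 : 'M[R]_n) = 1%:M.
Proof.
(* The partial sum with no term is 0, so the sequence is constant only from index 1 on. *)
apply/matrixP => i j; apply: mexp_lim; rewrite -(cvg_shiftS _) /=.
apply: cvg_near_cst; apply: nearW => K; rewrite /expS big_ord_recl /= fact0 invr1 scale1r.
rewrite big1 ?addr0 // => k _; rewrite /bump /= add1n expr0n /=.
by rewrite scaler0.
Qed.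


Lemma expn_scaled (L : algType R) (x y : L) K (k : 'I_K) : x * y = y * x ->
  (k`!)%:R^-1 *: (x + y) ^+ k =
  \sum_(j < K) \sum_(i < K | (i + j == k)%N)
     ((i`!)%:R^-1 * (j`!)%:R^-1) *: (x ^+ i * y ^+ j).
Proof.
move=> xy; rewrite exprDn_comm // scaler_sumr.
rewrite (big_ord_widen K (fun i => k`!%:R^-1 *: (x ^+ (k - i) * y ^+ i *+ 'C(k, i)))) //.
rewrite big_mkcond /=; apply: eq_bigr => j _; rewrite ltnS.
case: (leqP j k) => jk; last first.
  by rewrite big_pred0 // => i; apply/negbTE/eqP => e; move: jk; rewrite -e ltnNge leq_addl.
have hK : (k - j < K)%N by apply: leq_ltn_trans (leq_subr _ _) (ltn_ord k).
rewrite (big_pred1 (Ordinal hK)) /=; last first.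
  by move=> i; apply/eqP/eqP => [h|->/=]; [apply: val_inj => /=; lia|lia].
rewrite -(scaler_nat 'C(k, j)) scalerA; congr (_ *: _).
have /(congr1 (fun m : nat => m%:R : R)) := bin_fact jk; rewrite !natrM => <-.
have h m : (m`!)%:R != 0 :> R by rewrite pnatr_eq0 -lt0n fact_gt0.
rewrite !invfM mulrCA -[RHS]mulr1 mulrC.
have hC : ('C(k, j))%:R != 0 :> R by rewrite pnatr_eq0 -lt0n bin_gt0.
by field; rewrite !h hC.
Qed.

(** The product of the partial sums runs over the square i, j < K, the partial sum for x + y over
    the triangle i + j < K. The rest has nonnegative coefficients, so a matrix defect can be
    dominated by a scalar one. *)
Lemma exp_defect (L : algType R) (x y : L) K : x * y = y * x ->
  (\sum_(k < K) (k`!)%:R^-1 *: x ^+ k) * (\sum_(k < K) (k`!)%:R^-1 *: y ^+ k)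
  - \sum_(k < K) (k`!)%:R^-1 *: (x + y) ^+ k =
  \sum_(j < K) \sum_(i < K | (K <= i + j)%N)
     ((i`!)%:R^-1 * (j`!)%:R^-1) *: (x ^+ i * y ^+ j).
Proof.
move=> xy; under [X in _ - X]eq_bigr => k _ do rewrite (expn_scaled k xy).
rewrite [X in _ - X]exchange_big /= mulr_sumr -sumrB; apply: eq_bigr => j _.
rewrite (exchange_big_dep xpredT) //= mulr_suml -sumrB [RHS]big_mkcond /=.
apply: eq_bigr => i _; rewrite -scalerAl -scalerAr scalerA.
case: leqP => ij.
  rewrite big_pred0 ?subr0 // => k; apply/negbTE.
    by rewrite neq_ltn (leq_trans (ltn_ord k) ij) orbT.
by rewrite (big_pred1 (Ordinal ij)) ?subrr // => k; apply/eqP/eqP => [h|->//]; apply: val_inj.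
Qed.

Lemma mexpD n (A B : 'M[R]_n) : A *m B = B *m A -> mexp (A + B) = mexp A *m mexp B.
Proof.
case: n A B => [|n] A B AB; first by apply/matrixP => -[].
apply/matrixP => p q; apply: mexp_lim.
have [a ha] := rowbnd_ex A; have [b hb] := rowbnd_ex B.
have [a0 b0] : 0 <= a /\ 0 <= b by case: ha; case: hb.
pose e (x : R^o) K := \sum_(k < K) (k`!)%:R^-1 *: x ^+ k.
have ecvg (x : R) : e x @ \oo --> expR x.
  rewrite /e (_ : (fun K => _) = series (exp_coeff x)).
    exact: is_cvg_series_exp_coeff.
  apply: funext => K; rewrite /series /= big_mkord.
  by apply: eq_bigr => k _; rewrite /exp_coeff /= mulrC.
have prod : (fun K => (expS A K *m expS B K) p q) @ \oo --> (mexp A *m mexp B) p q.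
  rewrite mxE; under eq_fun do rewrite mxE.
  by apply: cvg_sumr => k; apply: cvgM; apply: expS_cvg.
(* The defect is dominated entrywise by the same defect for the scalars a, b,
   which tends to 0 because expR is a morphism. *)
have d0 : (fun K => (expS A K *m expS B K) p q - expS (A + B) K p q) @ \oo --> (0 : R).
  apply/norm_cvg0P.
  apply: (@squeeze_cvgr _ _ _ _ (fun=> 0) (fun K => e a K * e b K - e (a + b) K)).
  - apply: nearW => K; rewrite normr_ge0 /=.
    have -> : (expS A K *m expS B K) p q - expS (A + B) K p q
            = (expS A K * expS B K - expS (A + B) K) p q by rewrite !mxE.
    rewrite /expS /e exp_defect // exp_defect; last exact: mulrC.
    rewrite summxE; apply: le_trans (ler_norm_sum _ _ _) _; apply: ler_sum => j _.
    rewrite summxE; apply: le_trans (ler_norm_sum _ _ _) _; apply: ler_sum => i _.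
    have f0 m : 0 <= (m`!)%:R^-1 :> R by rewrite invr_ge0 ler0n.
    rewrite mxE normrM ger0_norm ?mulr_ge0 //.
    apply: ler_wpM2l; first exact: mulr_ge0.
    by apply/rowbnd_entry/rowbndM; apply: rowbndX.
  - exact: cvg_cst.
  - have -> : 0 = expR a * expR b - expR (a + b) by rewrite expRD subrr.
    by apply: cvgB; first apply: cvgM; apply: ecvg.
have -> : (fun K => expS (A + B) K p q) = (fun K => (expS A K *m expS B K) p q -
   ((expS A K *m expS B K) p q - expS (A + B) K p q)).
  by apply: funext => K; rewrite subKr.
by rewrite -[X in _ --> X]subr0; apply: cvgB.
Qed.

(** * Quadratic forms and decay of exp(-m A) *)

Definition bilin n (A : 'M[R]_n) (x y : 'cV[R]_n) : R := (x^T *m A *m y) 0 0.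

Lemma bilinDl n (A : 'M[R]_n) x x' y : bilin A (x + x') y = bilin A x y + bilin A x' y.
Proof. by rewrite /bilin linearD !mulmxDl mxE. Qed.
Lemma bilinDr n (A : 'M[R]_n) x y y' : bilin A x (y + y') = bilin A x y + bilin A x y'.
Proof. by rewrite /bilin mulmxDr mxE. Qed.
Lemma bilinZl n (A : 'M[R]_n) c x y : bilin A (c *: x) y = c * bilin A x y.
Proof. by rewrite /bilin linearZ /= -!scalemxAl mxE. Qed.
Lemma bilinZr n (A : 'M[R]_n) c x y : bilin A x (c *: y) = c * bilin A x y.
Proof. by rewrite /bilin -scalemxAr mxE. Qed.
Lemma bilinZ n (A : 'M[R]_n) c x y : bilin (c *: A) x y = c * bilin A x y.
Proof. by rewrite /bilin -scalemxAr -scalemxAl mxE. Qed.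
Lemma bilinD n (A B : 'M[R]_n) x y : bilin (A + B) x y = bilin A x y + bilin B x y.
Proof. by rewrite /bilin mulmxDr mulmxDl mxE. Qed.
Lemma bilinE n (A : 'M[R]_n) x y : bilin A x y = \sum_j (\sum_i x i 0 * A i j) * y j 0.
Proof.
rewrite /bilin mxE; apply: eq_bigr => j _; rewrite mxE; congr (_ * _).
by apply: eq_bigr => i _; rewrite mxE.
Qed.
Lemma bilinC n (A : 'M[R]_n) x y : symmetric_mx A -> bilin A x y = bilin A y x.
Proof.
move=> sA; rewrite /bilin.
have -> : x^T *m A *m y = (y^T *m A *m x)^T by rewrite !trmx_mul trmxK sA mulmxA.
by rewrite mxE.
Qed.

Definition psd n (A : 'M[R]_n) := forall x, 0 <= bilin A x x.

Lemma psd1 n : psd (1%:M : 'M[R]_n).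
Proof. by move=> x; rewrite /bilin mulmx1 mxE sumr_ge0 // => i _; rewrite mxE -expr2 sqr_ge0. Qed.

(** For an even exponent 2m the form is the squared length of A^m x; for 2m + 1 it is the form of A
    at A^m x. *)
Lemma psdX n (A : 'M[R]_n) k : symmetric_mx A -> psd A -> psd (A ^+ k).
Proof.
move=> sA pA; have sX m : symmetric_mx (A ^+ m).
  elim: m => [|m IH]; rewrite /symmetric_mx ?expr0 ?trmx1 // exprS trmx_mul IH sA.
  exact: (etrans (esym (exprSr A m)) (exprS A m)).
have mD m k' : A ^+ (m + k') = A ^+ m *m A ^+ k' by exact: exprD.
have mS m : A ^+ m.+1 = A ^+ m *m A by exact: exprSr.
have par m x : bilin (A ^+ (m + m)) x x = bilin 1%:M (A ^+ m *m x) (A ^+ m *m x).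
  by rewrite /bilin mulmx1 trmx_mul sX mD !mulmxA.
have par1 m x : bilin (A ^+ (m + m).+1) x x = bilin A (A ^+ m *m x) (A ^+ m *m x).
  by rewrite /bilin trmx_mul sX -addSn mD mS !mulmxA.
move=> x; rewrite -[k]odd_double_half -addnn; case: (odd k); rewrite ?add1n ?add0n.
  by rewrite par1.
by rewrite par; apply: psd1.
Qed.

(** The left side is the first two terms of the series; all later terms are nonnegative by
    [psdX]. *)
Lemma mexp_ge n (A : 'M[R]_n) x : symmetric_mx A -> psd A ->
  bilin 1%:M x x + bilin A x x <= bilin (mexp A) x x.
Proof.
move=> sA pA.
have c : (fun K => bilin (expS A K) x x) @ \oo --> bilin (mexp A) x x.
  rewrite bilinE; under eq_fun do rewrite bilinE.
  apply: cvg_sumr => j; apply: cvgMr_tmp.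
  by apply: cvg_sumr => i; apply: cvgMl_tmp; apply: expS_cvg.
rewrite -(cvg_lim _ c) //; apply: limr_ge; first by apply/cvg_ex; eexists; exact: c.
near=> K0; have : (2 <= K0)%N by near: K0; exact: nbhs_infty_ge.
move: (K0) => [|[|K]] // _; rewrite /expS 2!big_ord_recl /= fact0 invr1 !scale1r expr1 expr0 !bilinD.
rewrite lerD2l -[leLHS]addr0 lerD2l.
elim/big_ind: _ => [|B C hB hC|k _].
- by rewrite /bilin mulmx0 mul0mx mxE.
- by rewrite bilinD addr_ge0.
- by rewrite bilinZ mulr_ge0 ?invr_ge0 ?ler0n //; apply: psdX.
Unshelve. all: by end_near.
Qed.

(* Discriminant of s |-> form (s x + y). *)
Lemma psd_CS n (A : 'M[R]_n) x y : symmetric_mx A -> psd A ->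
  bilin A x y ^+ 2 <= bilin A x x * bilin A y y.
Proof.
move=> sA pA; have h s : 0 <= s ^+ 2 * bilin A x x + 2 * s * bilin A x y + bilin A y y.
  have := pA (s *: x + y); rewrite bilinDl !bilinDr !bilinZl !bilinZr (bilinC y x sA) => H.
  by apply: le_trans H _; lra.
have [x0|x0] := eqVneq (bilin A x x) 0.
  rewrite x0 mul0r; have [->|b0] := eqVneq (bilin A x y) 0; first by rewrite expr0n.
  (* Without its quadratic term the polynomial is affine in s; this s makes it equal to -1. *)
  have := h (- (bilin A y y + 1) / (2 * bilin A x y)); rewrite x0 mulr0 add0r.
  have -> : 2 * (- (bilin A y y + 1) / (2 * bilin A x y)) * bilin A x y = - (bilin A y y + 1) by field.
  by lra.
have xp : 0 < bilin A x x by rewrite lt_neqAle eq_sym x0 pA.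
(* The minimiser of the quadratic polynomial in s. *)
have := h (- bilin A x y / bilin A x x).
have -> : (- bilin A x y / bilin A x x) ^+ 2 * bilin A x x + 2 * (- bilin A x y / bilin A x x) * bilin A x y + bilin A y y
  = (bilin A x x * bilin A y y - bilin A x y ^+ 2) / bilin A x x by field.
by rewrite pmulr_lge0 ?invr_gt0 // subr_ge0.
Qed.

Lemma posdef_psd n (A : 'M[R]_n) : posdef_mx A -> psd A.
Proof.
move=> h x; have [->|/h/ltW//] := eqVneq x 0; by rewrite /bilin mulmx0 mxE.
Qed.

(** A nonzero row of the left kernel, transposed, would be a nonzero vector on which the form
    vanishes. *)
Lemma posdef_unit n (A : 'M[R]_n) : posdef_mx A -> A \in unitmx.
Proof.
move=> h; rewrite -row_free_unit -kermx_eq0; apply/eqP/row_matrixP => i; rewrite row0.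
apply/eqP/negPn/negP => r0.
have := h (row i (kermx A))^T; rewrite trmxK.
have -> : row i (kermx A) *m A = 0 by rewrite -row_mul mulmx_ker row0.
rewrite mul0mx mxE ltxx => /(_ _)/negP; apply=> //.
by apply: contra_neq r0 => /(congr1 trmx); rewrite trmxK trmx0.
Qed.

(* With D = exp(m A) and D y = v, one has y'y + m y'Ay <= y'Dy = y'v <= y'y + v'v/4. *)
Lemma mexp_decay_bound n (A : 'M[R]_n) (m : nat) (v : 'cV[R]_n) :
  symmetric_mx A -> psd A ->
  m%:R * bilin A (mexp (- (m%:R *: A)) *m v) (mexp (- (m%:R *: A)) *m v) <= bilin 1%:M v v.
Proof.
move=> sA pA; set D := mexp (m%:R *: A); set y := mexp _ *m v.
have Dy : D *m y = v.
  by rewrite mulmxA -mexpD ?subrr ?mexp0 ?mul1mx // mulmxN mulNmx.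
have := @mexp_ge _ (m%:R *: A) y _ _; rewrite bilinZ => H.
have {}H : bilin 1%:M y y + m%:R * bilin A y y <= bilin D y y.
  apply: H; first by rewrite /symmetric_mx linearZ /= sA.
  by move=> x; rewrite bilinZ mulr_ge0.
have e : bilin D y y = bilin 1%:M y v by rewrite /bilin mulmx1 -mulmxA Dy.
have := @psd1 n (y - v); have := @psd1 n v.
rewrite -scaleN1r bilinDl !bilinDr !bilinZl !bilinZr (bilinC v y (trmx1 R n)).
have := @psd1 n y; move: H; rewrite e.
set u := bilin _ y v; set w := bilin _ y y; set z := bilin _ v v; set g := _ * _.
lra.
Qed.

(** No spectral theorem is used. Entry (i, j) is the form of A between A^{-1} e_i and exp(-m A) e_j,
    so Cauchy-Schwarz for this form and [mexp_decay_bound] give a bound of order m^{-1/2}. *)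
Lemma mexp_decay n (A : 'M[R]_n) i j : symmetric_mx A -> posdef_mx A ->
  (fun m : nat => mexp (- (m%:R *: A)) i j) @ \oo --> (0 : R).
Proof.
move=> sA pA.
have uA := posdef_unit pA; have psA := posdef_psd pA.
pose v : 'cV[R]_n := delta_mx j 0; pose x : 'cV[R]_n := invmx A *m delta_mx i 0.
pose y m := mexp (- (m%:R *: A)) *m v.
have yE m : mexp (- (m%:R *: A)) i j = bilin A x (y m).
  rewrite /bilin trmx_mul trmx_inv sA -[_ *m _ *m A]mulmxA mulVmx // mulmx1 /y /v -colE.
  by rewrite trmx_delta -rowE !mxE.
pose C := bilin A x x * bilin 1%:M v v.
have bnd m : bilin A x (y m.+1) ^+ 2 <= C * m.+1%:R^-1.
  apply: le_trans (psd_CS _ _ sA psA) _; rewrite -mulrA ler_wpM2l //.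
  by rewrite ler_pdivlMr ?ltr0n // mulrC; apply: mexp_decay_bound.
rewrite -(cvg_shiftS _) /=; apply/norm_cvg0P.
apply: (@squeeze_cvgr _ _ _ _ (fun=> 0) (fun m => Num.sqrt (C * m.+1%:R^-1))).
- apply: nearW => m; rewrite normr_ge0 /= yE -sqrtr_sqr ler_wsqrtr //.
- exact: cvg_cst.
- have c0 : (fun m : nat => C * m.+1%:R^-1) @ \oo --> (0 : R).
    by rewrite -[X in _ --> X](mulr0 C); apply: cvgMl_tmp; exact: cvg_harmonic.
  by rewrite -[X in _ --> X]sqrtr0; exact: (cvg_comp _ _ c0 (@sqrt_continuous R 0)).
Qed.

End Mexp.

(** * Laws of fields *)

Section PathLaw.
Context {R : realType}.

(** [fdd_cyl] over any index type, so that the law of a whole path indexed by Z^N can be handled at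
    once. *)
Definition cyl (I : Type) (n : nat) : set (set (I -> 'I_n -> R)) :=
  fun B => exists (i : I) (j : 'I_n) (A : set R),
      measurable A /\ B = [set x | A (x i j)].

Lemma measurable_coord (I : Type) n (i : I) (j : 'I_n) :
  measurable_fun setT (fun x : g_sigma_algebraType (@cyl I n) => x i j).
Proof.
move=> _ A mA; rewrite setTI; apply: sub_sigma_algebra.
by exists i, j, A.
Qed.

Definition path_measurable d' (S : measurableType d') (I : Type) n (f : S -> I -> 'I_n -> R) :=
  forall i j, measurable_fun setT (fun s => f s i j).

Lemma measurable_path d' (S : measurableType d') (I : Type) n (f : S -> I -> 'I_n -> R) B :
  path_measurable f -> <<s @cyl I n >> B -> measurable (f @^-1` B).
Proof.
move=> mf mB.
have H : measurable_fun setT (f : S -> g_sigma_algebraType (@cyl I n)).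
  apply: (@measurability _ _ S (g_sigma_algebraType (@cyl I n)) setT f (@cyl I n) erefl).
  move=> _ [_ [i [j [A [mA ->]]]] <-].
  exact: (mf i j).
by rewrite -[X in measurable X]setTI; apply: H.
Qed.

Lemma measurable_forall d' (S : measurableType d') (I : finType) (F : I -> set S) :
  (forall i, measurable (F i)) -> measurable [set x | forall i, F i x].
Proof.
move=> mF; rewrite (_ : [set x | _] = \bigcap_(i in [set: I]) F i).
  by apply: fin_bigcap_measurable => //; exact: finite_finset.
by apply/seteqP; split=> x /= h i; [move=> _; exact: h|exact: h].
Qed.

(** The events of joint distribution functions. The bound [+oo] leaves a coordinate free, which
    makes the family stable under intersection. *)
Definition orth (I : eqType) n (s : seq I) (c : I -> 'I_n -> \bar R) : set (I -> 'I_n -> R) :=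
  [set x | forall i, i \in s -> forall j, ((x i j)%:E <= c i j)%E].

Lemma measurable_orth (I : eqType) n (s : seq I) (c : I -> 'I_n -> \bar R) :
  <<s @cyl I n >> (orth s c).
Proof.
suff : (@cyl I n).-sigma.-measurable (orth s c) by [].
elim: s => [|i s IH].
  by rewrite (_ : orth _ _ = setT) //; apply/seteqP; split.
rewrite (_ : orth _ _ = [set x | forall j, ((x i j)%:E <= c i j)%E] `&` orth s c).
  apply: measurableI => //.
  pose S j := [set x : g_sigma_algebraType (@cyl I n) | ((x i j)%:E <= c i j)%E].
  apply: (@measurable_forall _ _ _ S) => j.
  rewrite (_ : S j = (fun x : g_sigma_algebraType (@cyl I n) => x i j) @^-1`
     [set r | (r%:E <= c i j)%E]) //.
  rewrite -[X in measurable X]setTI; apply: (measurable_coord i j) => //.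
  case: (c i j) => [r| |].
  - rewrite (_ : mkset _ = `]-oo, r]%classic); first exact: measurable_itv.
    by apply/seteqP; split=> x /=; rewrite in_itv /= lee_fin.
  - rewrite (_ : mkset _ = setT); first exact: measurableT.
    by apply/seteqP; split=> x //= _; exact: leey.
  - rewrite (_ : mkset _ = set0); first exact: measurable0.
    by apply/seteqP; split.
apply/seteqP; split=> x /=.
  by move=> h; split=> [|k ks]; apply: h; rewrite ?mem_head // inE ks orbT.
by move=> [h1 h2] k; rewrite inE => /orP[/eqP->//|]; exact: h2.
Qed.

Definition orthants (I : eqType) n : set (set (I -> 'I_n -> R)) :=
  fun B => exists s c, B = orth s c.

Lemma orthants_setI (I : eqType) n : setI_closed (@orthants I n).
Proof.
move=> _ _ [s1 [c1 ->]] [s2 [c2 ->]].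
(* Outside s the function c imposes nothing but may be finite; it is reset to [+oo] before the
   minimum is taken. *)
pose c0 (s : seq I) (c : I -> 'I_n -> \bar R) i j := if i \in s then c i j else +oo%E.
exists (s1 ++ s2), (fun i j => mine (c0 s1 c1 i j) (c0 s2 c2 i j)).
apply/seteqP; split=> x /=.
  move=> [h1 h2] i _ j; rewrite le_min /c0.
  by apply/andP; split; case: ifP => hi; rewrite ?leey //; [exact: h1|exact: h2].
move=> h; split=> i hi j; have := h i; rewrite mem_cat hi ?orbT => /(_ isT j);
  by rewrite le_min /c0 hi => /andP[].
Qed.

(** The rays above r generate the Borel sets, and a coordinate lies in such a ray exactly off an
    orthant with one finite bound. *)
Lemma cyl_orthants (I : eqType) n : <<s @cyl I n >> `<=` <<s @orthants I n >>.
Proof.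
apply: smallest_sub; first exact: smallest_sigma_algebra.
move=> _ [i [j [A [mA ->]]]].
suff H : measurable_fun setT (fun x : g_sigma_algebraType (@orthants I n) => x i j).
  by have := H measurableT _ mA; rewrite setTI.
apply: (measurability _ (RGenOInfty.measurableE R)).
move=> _ [_ [r ->] <-]; rewrite setTI.
rewrite (_ : _ @^-1` _ = ~` orth [:: i] (fun _ k => if k == j then r%:E else +oo%E)).
  by apply: measurableC; apply: sub_sigma_algebra; do 2 eexists.
apply/seteqP; split=> x /=; rewrite in_itv /= andbT.
  move=> rx /(_ i (mem_head _ _) j); rewrite eqxx lee_fin.
  by rewrite leNgt rx.
move=> h; rewrite ltNge; apply/negP => xr; apply: h => k; rewrite inE => /eqP-> l.
by case: eqP => [->|_]; rewrite ?lee_fin ?leey.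
Qed.

Context {d : measure_display} {T : measurableType d} (P : probability T R).

Definition law_eq (I : Type) n (X Y : T -> I -> 'I_n -> R) :=
  forall B, <<s @cyl I n >> B -> P (X @^-1` B) = P (Y @^-1` B).

Lemma law_comp (I J : Type) n m (X Y : T -> I -> 'I_n -> R)
    (phi : g_sigma_algebraType (@cyl I n) -> J -> 'I_m -> R) :
  path_measurable phi -> law_eq X Y -> law_eq (fun w => phi (X w)) (fun w => phi (Y w)).
Proof.
move=> mphi XY B mB.
have mphiB : (@cyl I n).-sigma.-measurable (phi @^-1` B) := measurable_path mphi mB.
exact: (XY (phi @^-1` B) mphiB).
Qed.

(** The pi-lambda theorem: orthants form a pi-system, and the sets on which both laws agree form a
    lambda-system. *)
Lemma law_orthants (I : eqType) n (X Y : T -> I -> 'I_n -> R) :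
  path_measurable X -> path_measurable Y ->
  (forall s c, P (X @^-1` orth s c) = P (Y @^-1` orth s c)) -> law_eq X Y.
Proof.
move=> mX mY h B mB.
pose H := [set C | [/\ measurable (X @^-1` C), measurable (Y @^-1` C) &
   P (X @^-1` C) = P (Y @^-1` C)]].
suff : H B by case.
apply: (lambda_system_subset (@orthants_setI I n) _ _ _ (cyl_orthants mB)) => //; last first.
  move=> _ [s [c ->]]; split; last exact: h.
  - exact: measurable_path (measurable_orth _ _).
  - exact: measurable_path (measurable_orth _ _).
split=> //.
- by split; rewrite ?preimage_setT //; exact: measurableT.
- move=> C D DC [mXC mYC eC] [mXD mYD eD]; split; rewrite ?preimage_setD; try exact: measurableD.
  rewrite !measureD //; try by rewrite ltey_eq fin_num_measure.
  have XD : X @^-1` C `&` X @^-1` D = X @^-1` D by apply/setIidPr => w; exact: DC.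
  have YD : Y @^-1` C `&` Y @^-1` D = Y @^-1` D by apply/setIidPr => w; exact: DC.
  by rewrite XD YD; congr (_ - _)%E.
- move=> F ndF HF; split; rewrite ?preimage_bigcup.
  + by apply: bigcup_measurable => k _; case: (HF k).
  + by apply: bigcup_measurable => k _; case: (HF k).
  have cX : (P \o (fun k => X @^-1` F k)) @ \oo --> P (\bigcup_k (X @^-1` F k)).
    apply: nondecreasing_cvg_mu; first by move=> k; case: (HF k).
    + by apply: bigcup_measurable => k _; case: (HF k).
    + by move=> k l kl; apply/subsetPset => w; have /subsetPset := ndF _ _ kl; apply.
  have cY : (P \o (fun k => Y @^-1` F k)) @ \oo --> P (\bigcup_k (Y @^-1` F k)).
    apply: nondecreasing_cvg_mu; first by move=> k; case: (HF k).
    + by apply: bigcup_measurable => k _; case: (HF k).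
    + by move=> k l kl; apply/subsetPset => w; have /subsetPset := ndF _ _ kl; apply.
  have E : (P \o (fun k => X @^-1` F k)) = (P \o (fun k => Y @^-1` F k)).
    by apply: funext => k /=; case: (HF k).
  by rewrite E in cX; exact: (cvg_unique _ cX cY).
Qed.

(** An orthant is the decreasing intersection of the orthants with bounds enlarged by 1/(k+1).
    Continuity from above thus absorbs the slack, with no need for continuity points of a
    distribution function. *)
Lemma orth_le (I : eqType) n (X Y : T -> I -> 'I_n -> R) s c : path_measurable Y ->
  (forall eps dlt : R, 0 < eps -> 0 < dlt ->
     (P (X @^-1` orth s c) <= P (Y @^-1` orth s (fun i j => c i j + eps%:E)) + dlt%:E)%E) ->
  (P (X @^-1` orth s c) <= P (Y @^-1` orth s c))%E.
Proof.
move=> mY h.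
pose F k := Y @^-1` orth s (fun i j => (c i j + (k.+1%:R^-1)%:E)%E).
have mo c' : measurable (Y @^-1` orth s c') by apply: measurable_path (measurable_orth _ _).
have cF : \bigcap_k F k = Y @^-1` orth s c.
  apply/seteqP; split=> w /=.
    move=> hw i si j; apply/lee_addgt0Pr => e e0.
    have [k _ hk] := near_infty_natSinv_lt (PosNum e0).
    apply: (le_trans (hw k Logic.I i si j)); apply: leeD2l.
    by rewrite lee_fin ltW //; apply: hk => /=.
  by move=> hw k _ i si j; apply: (le_trans (hw i si j)); rewrite leeDl // lee_fin invr_ge0.
have : (P \o F) @ \oo --> P (Y @^-1` orth s c).
  rewrite -cF; apply: nonincreasing_cvg_mu => //.
  - by rewrite ltey_eq fin_num_measure //; exact: mo.
  - by move=> k; exact: mo.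
  - by rewrite cF; exact: mo.
  - move=> k l kl; apply/subsetPset => w hw i si j; apply: (le_trans (hw i si j)).
    by apply: leeD2l; rewrite lee_fin lef_pV2 ?posrE ?ltr0n // ler_nat ltnS.
move=> cvF; rewrite -(cvg_lim _ cvF) //; apply: lime_ge; first by apply/cvg_ex; eexists; exact: cvF.
by apply: nearW => k /=; apply/lee_addgt0Pr => e e0; apply: h => //; rewrite invr_gt0 ltr0n.
Qed.

End PathLaw.

Lemma norm_leP (R : realType) n (v : 'cV[R]_n) (e : R) : 0 <= e ->
  `|v| <= e <-> forall j, `|v j 0| <= e.
Proof.
move=> e0; rewrite (_ : `|v| = mx_norm v) // mx_normrE; split.
  move=> h j; apply: le_trans h.
  by have := le_bigmax 0 (fun ij : 'I_n * 'I_1 => `|v ij.1 ij.2|) (j, 0).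
by move=> h; apply: bigmax_le => // -[i j] _ /=; rewrite (ord1 j).
Qed.

(** * Measurability of increments, box sums and distance events *)

Section Measurability.
Context {R : realType} {d : measure_display} {T : measurableType d}.

Lemma rvec_meas_mulmx n (A : 'M[R]_n) (U : @rvec R d T n) :
  rvec_meas U -> rvec_meas (fun w => A *m U w).
Proof.
move=> mU i; under eq_fun do rewrite mxE.
apply: measurable_sum => k; apply: measurable_funM => //.
Qed.

Lemma rvec_meas_sum n (I : finType) (p : pred I) (U : I -> @rvec R d T n) :
  (forall i, rvec_meas (U i)) -> rvec_meas (fun w => \sum_(i | p i) U i w).
Proof.
move=> mU j; under eq_fun do rewrite summxE big_mkcond /=.
by apply: measurable_sum => k; case: (p k); [exact: mU|exact: measurable_cst].
Qed.

Lemma rvec_meas_scale n c (U : @rvec R d T n) :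
  rvec_meas U -> rvec_meas (fun w => c *: U w).
Proof. by move=> mU i; under eq_fun do rewrite mxE; exact: measurable_funM. Qed.

Lemma rvec_meas0 n : rvec_meas (fun _ : T => 0 : 'cV[R]_n).
Proof. by move=> i; exact: measurable_cst. Qed.

Lemma Delta_meas N n (X : @field R d T N n) : is_field X -> is_field (Delta X).
Proof.
by move=> mX t; apply: rvec_meas_sum => b; apply: rvec_meas_scale.
Qed.

Lemma box_sum_meas N n lo hi (X : @field R d T N n) : is_field X ->
  rvec_meas (fun w => box_sum lo hi (fun j => X j w)).
Proof. by move=> mX; apply: rvec_meas_sum => b. Qed.

Lemma DeltaE N n (X : @field R d T N n) t w :
  Delta X t w = tensor_sum (fun l => @bsgn R) (fun l (b : bool) => t l - (b : nat)%:Z) (fun s => X s w).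
Proof.
by apply: eq_bigr => f _; rewrite /bsgn prodrXr.
Qed.

Definition far n (e : R) (U V : @rvec R d T n) : set T := [set w | e < `|U w - V w|].

Lemma measurable_far n (e : R) (U V : @rvec R d T n) : 0 <= e ->
  rvec_meas U -> rvec_meas V -> measurable (far e U V).
Proof.
move=> e0 mU mV; pose S j := [set w | `|U w j 0 - V w j 0| <= e].
rewrite (_ : far e U V = ~` [set w | forall j, S j w]).
  apply: measurableC; apply: (measurable_forall (F := S)) => j.
  have mf : measurable_fun setT (fun w => `|U w j 0 - V w j 0|).
    by apply: measurableT_comp => //; exact: measurable_funB.
  rewrite (_ : S j = setT `&` (fun w => `|U w j 0 - V w j 0|) @^-1` `]-oo, e]%classic).
    by apply: mf => //; exact: measurable_itv.
  by rewrite setTI; apply/seteqP; split=> w /=; rewrite in_itv.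
apply/seteqP; split=> w /=; rewrite /far /=.
  move=> h1 h2; move: h1; rewrite ltNge => /negP; apply.
  by apply/norm_leP => // j; rewrite !mxE; exact: h2.
move=> h; rewrite ltNge; apply/negP => /norm_leP h2; apply: h => j.
by have := h2 e0 j; rewrite !mxE.
Qed.

Lemma far_sub n (e1 e2 : R) (U V W : @rvec R d T n) :
  far (e1 + e2) U W `<=` far e1 U V `|` far e2 V W.
Proof.
move=> w; rewrite /far /= => h; apply/orP; rewrite !ltNge -negb_and.
apply/negP => /andP[h1 h2]; move: h; rewrite ltNge => /negP; apply.
by rewrite -[U w](subrK (V w)) -addrA (le_trans (ler_normD _ _)) // lerD.
Qed.

Lemma far_sym n (e : R) (U V : @rvec R d T n) : far e U V = far e V U.
Proof. by rewrite /far; apply: funext => w /=; rewrite distrC. Qed.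

End Measurability.

(** * Equality in law of fields and its stability under approximation *)

Section FieldLaw.
Context {R : realType} {d : measure_display} {T : measurableType d} (P : probability T R).

Definition coords N n (X : @field R d T N n) : T -> ('I_N -> int) -> 'I_n -> R :=
  fun w t j => X t w j 0.

(** An orthant constrains finitely many times, so it is a finite-dimensional event; [law_orthants]
    extends the equality to all path events. *)
Lemma eq_fdd_law N n (X Y : @field R d T N n) : is_field X -> is_field Y ->
  eq_fdd P X Y -> law_eq P (coords X) (coords Y).
Proof.
move=> mX mY h; apply: law_orthants => // s c.
pose c' (i : 'I_(size s)) j := c (nth (fun=> 0) s i) j.
have := h s (orth (enum 'I_(size s)) c') (measurable_orth _ _).
have E (Z : @field R d T N n) : [set w | orth (enum 'I_(size s)) c'
   (fun i j => Z (nth (fun=> 0) s i) w j 0)] = coords Z @^-1` orth s c.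
  apply/seteqP; split=> w /= hw.
    move=> t ts j; have hi : (index t s < size s)%N by rewrite index_mem.
    by have := hw (Ordinal hi) (mem_enum _ _) j; rewrite /c' /= nth_index.
  by move=> i _ j; apply: hw; rewrite mem_nth.
by rewrite !E.
Qed.

Lemma law_eq_fdd N n (X Y : @field R d T N n) :
  law_eq P (coords X) (coords Y) -> eq_fdd P X Y.
Proof.
move=> h ts B mB.
pose r (x : g_sigma_algebraType (@cyl R ('I_N -> int) n)) (i : 'I_(size ts)) :=
  x (nth (fun=> 0) ts i).
have mr : path_measurable r by move=> i j; exact: measurable_coord.
exact: (law_comp mr h mB).
Qed.

Definition pathT N n := g_sigma_algebraType (@cyl R ('I_N -> int) n).

(** The canonical field on path space. Field operations applied to it give the measurable
    functionals that [law_op] transports. *)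
Definition coord_field N n : @field R _ (pathT N n) N n := fun t x => \col_k x t k.

Lemma coord_field_meas N n : is_field (@coord_field N n).
Proof.
move=> t i; rewrite (_ : (fun w => _) = (fun x : pathT N n => x t i)).
  exact: measurable_coord.
by apply: funext => x; rewrite mxE.
Qed.

Lemma coord_fieldE N n (X : @field R d T N n) t w : coord_field t (coords X w) = X t w.
Proof. by apply/matrixP => i j; rewrite mxE (ord1 j). Qed.

Lemma law_op N n (Psi : @field R _ (pathT N n) N n) (X Y X' Y' : @field R d T N n) :
  is_field Psi -> law_eq P (coords X) (coords Y) ->
  (forall t w, X' t w = Psi t (coords X w)) -> (forall t w, Y' t w = Psi t (coords Y w)) ->
  law_eq P (coords X') (coords Y').
Proof.
move=> mPsi h hX hY.
have -> : coords X' = fun w => (fun x t j => Psi t x j 0) (coords X w).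
  by apply: funext => w; rewrite /coords; apply: funext => t; apply: funext => j; rewrite hX.
have -> : coords Y' = fun w => (fun x t j => Psi t x j 0) (coords Y w).
  by apply: funext => w; rewrite /coords; apply: funext => t; apply: funext => j; rewrite hY.
exact: (law_comp (phi := fun x t j => Psi t x j 0)).
Qed.

(** The union bound over a finite list of times. *)
Lemma bad_bound (I : eqType) n (X X' : I -> @rvec R d T n) (s : seq I) (e dlt : R) :
  0 <= e -> (forall i, rvec_meas (X i)) -> (forall i, rvec_meas (X' i)) ->
  (forall t, t \in s -> (P (far e (X t) (X' t)) <= dlt%:E)%E) ->
  let bad := [set w | exists2 t, t \in s & far e (X t) (X' t) w] in
  measurable bad /\ (P bad <= ((size s)%:R * dlt)%:E)%E.
Proof.
move=> e0 mX mX'; elim: s => [|t s IH] h /=.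
  rewrite (_ : [set w | _] = set0) ?measure0 ?mul0r //.
  by apply/seteqP; split=> w // -[].
have [mb Pb] := IH (fun u us => h u (mem_behead (s := t :: s) us)).
set b := [set w | _] in mb Pb.
rewrite (_ : [set w | _] = far e (X t) (X' t) `|` b); last first.
  apply/seteqP; split=> w /=.
    move=> [u]; rewrite inE => /orP[/eqP->|us hu]; [by left|right].
    by exists u.
  by move=> [hu|[u us hu]]; [exists t; rewrite ?mem_head|exists u; rewrite // inE us orbT].
have mf : measurable (far e (X t) (X' t)) by apply: measurable_far.
split; first exact: measurableU.
apply: le_trans (measureU2 _ _ _) _ => //.
rewrite mulrSr mulrDl mul1r addrC EFinD; apply: leeD => //.
by apply: h; rewrite mem_head.
Qed.

Lemma orth_far N n (X X' : @field R d T N n) s c (e dlt : R) :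
  0 <= e -> is_field X -> is_field X' ->
  (forall t, t \in s -> (P (far e (X t) (X' t)) <= dlt%:E)%E) ->
  (P (coords X @^-1` orth s c) <=
   P (coords X' @^-1` orth s (fun i j => c i j + e%:E)) + ((size s)%:R * dlt)%:E)%E.
Proof.
move=> e0 mX mX' h; have [mb Pb] := bad_bound e0 mX mX' h.
set b := [set w | _] in mb Pb.
have mo (Z : @field R d T N n) c' : is_field Z -> measurable (coords Z @^-1` orth s c').
  by move=> mZ; apply: measurable_path (measurable_orth _ _).
apply: (@le_trans _ _ (P (coords X' @^-1` orth s (fun i j => c i j + e%:E)%E `|` b))).
  apply: le_measure; rewrite ?inE; [exact: mo|by apply: measurableU => //; exact: mo|].
  move=> w hw; have [hb|hb] := pselect (b w); [by right|left] => t ts j.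
  have : `|X t w - X' t w| <= e.
    by rewrite leNgt; apply/negP => hh; apply: hb; exists t.
  move/norm_leP => /(_ e0 j); rewrite !mxE => hd.
  have := hw t ts j; rewrite /coords; case: (c t j) => [r|_|]; [|by rewrite addye // leey|by []].
  rewrite -EFinD !lee_fin => hr; move: hd; rewrite ler_norml; lra.
apply: le_trans (measureU2 _ _ _) _ => //; first exact: mo.
by apply: leeD.
Qed.

(** On an orthant one passes from X to X', then in law to Y', then to Y; each of the two
    approximations costs a slack and a probability. The reverse inequality exchanges the roles. *)
Lemma law_approx N n (X Y : @field R d T N n) : is_field X -> is_field Y ->
  (forall (s : seq ('I_N -> int)) (e dlt : R), 0 < e -> 0 < dlt ->
     exists X' Y' : @field R d T N n,
     [/\ is_field X', is_field Y', law_eq P (coords X') (coords Y') &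
       forall t, t \in s -> (P (far e (X t) (X' t)) <= dlt%:E)%E /\
                            (P (far e (Y t) (Y' t)) <= dlt%:E)%E]) ->
  law_eq P (coords X) (coords Y).
Proof.
have half (A B : @field R d T N n) s c : is_field A -> is_field B ->
  (forall (e dlt : R), 0 < e -> 0 < dlt ->
     exists X' Y' : @field R d T N n,
     [/\ is_field X', is_field Y', law_eq P (coords X') (coords Y') &
       forall t, t \in s -> (P (far e (A t) (X' t)) <= dlt%:E)%E /\
                            (P (far e (B t) (Y' t)) <= dlt%:E)%E]) ->
  (P (coords A @^-1` orth s c) <= P (coords B @^-1` orth s c))%E.
  move=> mA mB h; apply: orth_le => // e dlt e0 d0.
  have e2 : 0 < e / 2 by rewrite divr_gt0.
  (* Each of the two passages loses [size s] times the individual error; the successor covers the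
     empty list. *)
  have k0 : 0 < 2 * (size s).+1%:R :> R by rewrite mulr_gt0 ?ltr0n.
  have d2 : 0 < dlt / (2 * (size s).+1%:R) by rewrite divr_gt0.
  have [X' [Y' [mX' mY' hl hc]]] := h _ _ e2 d2.
  set d' := _ / _ in d2 hc.
  have := @orth_far N n A X' s c (e / 2) d' (ltW e2) mA mX' (fun t ts => (hc t ts).1).
  move/le_trans; apply; rewrite (hl _ (measurable_orth _ _)).
  have := @orth_far N n Y' B s (fun i j => c i j + (e / 2)%:E)%E (e / 2) d' (ltW e2) mY' mB.
  move=> H; apply: le_trans (leeD (H _) (le_refl _)) _.
    by move=> t ts; rewrite far_sym; case: (hc t ts).
  rewrite -addeA -EFinD.
  have -> : (fun i j => c i j + (e / 2)%:E + (e / 2)%:E)%E = (fun i j => c i j + e%:E)%E.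
    by apply: funext => i; apply: funext => j; rewrite -addeA -EFinD -splitr.
  apply: leeD2l; rewrite lee_fin -mulrDl -natrD /d'.
  rewrite mulrA ler_pdivrMr // mulrC ler_wpM2l ?(ltW d0) //.
  by rewrite -natrM ler_nat; lia.
move=> mX mY h; apply: law_orthants => // s c; apply/eqP; rewrite eq_le; apply/andP; split.
  by apply: half => // e dlt e0 d0; apply: h.
apply: half => // e dlt e0 d0; have [X' [Y' [mX' mY' hl hc]]] := h s e dlt e0 d0.
exists Y', X'; split => //; first by move=> B mB; rewrite hl.
by move=> t /hc[].
Qed.

End FieldLaw.

(** * Iterated limits in probability *)

Definition eventually_nat (Q : nat -> Prop) := exists K, forall M, (K <= M)%N -> Q M.

Lemma near_eventually (Q : nat -> Prop) : (\forall M \near \oo, Q M) <-> eventually_nat Q.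
Proof.
split; first by move=> [K _ h]; exists K => M KM; exact: h.
by move=> [K h]; exists K => // M KM; exact: h.
Qed.

(* Iterated "eventually", nested in the order of the iterated limit. *)
Fixpoint iev (k : nat) (Q : seq nat -> Prop) : Prop :=
  if k is k'.+1 then eventually_nat (fun M => iev k' (fun ms => Q (M :: ms))) else Q [::].

Lemma iev_mono k (Q Q' : seq nat -> Prop) :
  (forall ms, size ms = k -> Q ms -> Q' ms) -> iev k Q -> iev k Q'.
Proof.
elim: k Q Q' => [|k IH] Q Q' h /=; first exact: h.
move=> [K hK]; exists K => M KM; apply: IH (hK M KM) => ms sz; apply: h.
by rewrite /= sz.
Qed.

Lemma iev_all k (Q : seq nat -> Prop) : (forall ms, size ms = k -> Q ms) -> iev k Q.
Proof.
elim: k Q => [|k IH] Q h /=; first exact: h.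
by exists 0%N => M _; apply: IH => ms sz; apply: h; rewrite /= sz.
Qed.

Lemma iev_and k (Q Q' : seq nat -> Prop) :
  iev k Q -> iev k Q' -> iev k (fun ms => Q ms /\ Q' ms).
Proof.
elim: k Q Q' => [|k IH] Q Q' //= [K hK] [K' hK'].
exists (maxn K K') => M; rewrite geq_max => /andP[h h'].
by apply: IH; [exact: hK|exact: hK'].
Qed.

Lemma iev_forall (I : eqType) k (s : seq I) (Q : I -> seq nat -> Prop) :
  (forall i, i \in s -> iev k (Q i)) -> iev k (fun ms => forall i, i \in s -> Q i ms).
Proof.
elim: s => [|i s IH] h; first exact: iev_all.
have h1 := h i (mem_head _ _).
have h2 := IH (fun j js => h j (mem_behead (s := i :: s) js)).
apply: iev_mono (iev_and h1 h2) => ms _ [q1 q2] j; rewrite inE => /orP[/eqP->//|]; exact: q2.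
Qed.

(** With [iev_and] and [iev_forall], this yields one tuple at which finitely many iterated limits
    are all nearly attained. *)
Lemma iev_ex k (Q : seq nat -> Prop) : iev k Q -> exists2 ms, size ms = k & Q ms.
Proof.
elim: k Q => [|k IH] Q /=; first by exists [::].
by move=> [K /(_ K (leqnn K))/IH[ms sz q]]; exists (K :: ms); rewrite /= ?sz.
Qed.

Lemma iev_ge k K : iev k (fun ms => forall l, (l < k)%N -> (K <= nth 0 ms l)%N).
Proof.
elim: k => [//|k IH] /=; exists K => M KM; apply: iev_mono IH => ms _ h [|l] //= lk.
exact: h.
Qed.

Fixpoint map_index (phi : nat -> nat -> nat) (ms : seq nat) : seq nat :=
  if ms is M :: ms' then phi 0%N M :: map_index (fun l => phi l.+1) ms' else [::].

Lemma nth_map_index phi ms l : (l < size ms)%N -> nth 0%N (map_index phi ms) l = phi l (nth 0%N ms l).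
Proof.
elim: ms phi l => [|M ms IH] phi [|l] //= h.
exact: (IH (fun l => phi l.+1)).
Qed.

(** Each coordinate is reindexed by a map tending to infinity that ignores the other coordinates, so
    the order of the limits is respected. *)
Lemma iev_map_index phi k (Q : seq nat -> Prop) :
  (forall l K, eventually_nat (fun M => K <= phi l M)%N) ->
  iev k Q -> iev k (fun ms => Q (map_index phi ms)).
Proof.
elim: k phi Q => [|k IH] phi Q //= hphi [K hK].
have [K' hK'] := hphi 0%N K; exists K' => M KM.
apply: (IH (fun l => phi l.+1) (fun ms => Q (phi 0%N M :: ms))) => //.
exact/hK/hK'.
Qed.

(** * Convergence in probability, simple and iterated *)

Section Convergence.
Context {R : realType} {d : measure_display} {T : measurableType d} (P : probability T R).

Lemma prob_cvg0P (S : nat -> set T) : (forall m, measurable (S m)) ->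
  (fun m => P (S m)) @ \oo --> 0%E <->
  forall dlt : R, 0 < dlt -> eventually_nat (fun m => (P (S m) <= dlt%:E)%E).
Proof.
move=> mS; have fS m : P (S m) \is a fin_num by apply: fin_num_measure.
split.
  move=> /fine_cvgP[_ /cvgrPdist_le h] dlt d0.
  have /near_eventually[K hK] := h _ d0; exists K => m /hK /=.
  rewrite sub0r normrN ger0_norm ?fine_ge0 ?measure_ge0 // => hm.
  by rewrite -(fineK (fS m)) lee_fin.
move=> h; apply/fine_cvgP; split; first by apply: nearW => m; exact: fS.
apply/cvgrPdist_le => e e0; apply/near_eventually.
have [K hK] := h e e0; exists K => m /hK hm /=.
rewrite sub0r normrN ger0_norm ?fine_ge0 ?measure_ge0 //.
by rewrite -lee_fin fineK.
Qed.

Lemma cvg_probP n (Xs : nat -> rvec n) (X : rvec n) : (forall m, rvec_meas (Xs m)) ->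
  rvec_meas X ->
  cvg_prob P Xs X <-> forall e dlt : R, 0 < e -> 0 < dlt ->
     eventually_nat (fun m => (P (far e (Xs m) X) <= dlt%:E)%E).
Proof.
move=> mXs mX; split.
  move=> [_ h] e dlt e0; have /prob_cvg0P := h e e0; apply => m.
  exact: (measurable_far (ltW e0)).
move=> h; split => // e e0; apply/prob_cvg0P => [m|dlt]; last exact: h.
exact: (measurable_far (ltW e0)).
Qed.

Lemma cvg_iter_meas n k (F : seq nat -> rvec n) L :
  (forall ms, size ms = k -> rvec_meas (F ms)) -> cvg_iter P k F L -> rvec_meas L.
Proof.
case: k => [|k] mF /=; first by move=> <-; exact: mF.
by move=> [Gs [_ []]].
Qed.

Lemma far_leD n (e1 e2 d1 d2 : R) (U V W : @rvec R d T n) : 0 <= e1 -> 0 <= e2 ->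
  rvec_meas U -> rvec_meas V -> rvec_meas W ->
  (P (far e1 U V) <= d1%:E)%E -> (P (far e2 V W) <= d2%:E)%E ->
  (P (far (e1 + e2) U W) <= (d1 + d2)%:E)%E.
Proof.
move=> e10 e20 mU mV mW h1 h2.
have m1 := measurable_far e10 mU mV; have m2 := measurable_far e20 mV mW.
apply: (@le_trans _ _ (P (far e1 U V `|` far e2 V W))).
  apply: le_measure; rewrite ?inE; last exact: far_sub.
  - exact: (measurable_far (addr_ge0 e10 e20) mU mW).
  - exact: measurableU.
by apply: le_trans (measureU2 _ m1 m2) _; rewrite EFinD; apply: leeD.
Qed.

Lemma far_refl n (e : R) (U : @rvec R d T n) : 0 <= e -> far e U U = set0.
Proof.
move=> e0; rewrite /far; apply/seteqP; split => w //=.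
by rewrite subrr normr0 ltNge e0.
Qed.

(** At each level both tolerances are halved: the inner sum is close to the intermediate limit
    [Gs M], which is close to [L]. *)
Lemma cvg_iter_iev n k (F : seq nat -> rvec n) L :
  (forall ms, size ms = k -> rvec_meas (F ms)) -> cvg_iter P k F L ->
  forall e dlt : R, 0 < e -> 0 < dlt ->
  iev k (fun ms => (P (far e (F ms) L) <= dlt%:E)%E).
Proof.
elim: k F L => [|k IH] F L mF /=.
  by move=> <- e dlt e0 d0; rewrite far_refl ?(ltW e0) // measure0 lee_fin ltW.
move=> [Gs [hG hL]] e dlt e0 d0.
have mF' M ms : size ms = k -> rvec_meas (F (M :: ms)) by move=> sz; apply: mF; rewrite /= sz.
have mG M : rvec_meas (Gs M) by apply: cvg_iter_meas (hG M) => ms; exact: mF'.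
have mL : rvec_meas L by case: hL.
have e2 : 0 < e / 2 by rewrite divr_gt0.
have d2 : 0 < dlt / 2 by rewrite divr_gt0.
have [K hK] := (cvg_probP mG mL).1 hL _ _ e2 d2.
exists K => M KM; apply: iev_mono (IH _ _ (mF' M) (hG M) _ _ e2 d2) => ms sz h.
rewrite [e]splitr [dlt]splitr; apply: far_leD (ltW e2) (ltW e2) _ _ _ h (hK M KM) => //.
exact: mF'.
Qed.

(** The event that U and V differ is the union of the null events that they differ by more than
    1/(k+1). *)
Lemma ae_eq_far n (U V : @rvec R d T n) : rvec_meas U -> rvec_meas V ->
  (forall e dlt : R, 0 < e -> 0 < dlt -> (P (far e U V) <= dlt%:E)%E) ->
  {ae P, forall w, U w = V w}.
Proof.
move=> mU mV h; pose S k := far (k.+1%:R^-1) U V.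
have k0 k : 0 < k.+1%:R^-1 :> R by rewrite invr_gt0 ltr0n.
have mS k : measurable (S k) by apply: measurable_far => //; exact: ltW.
apply: (@negligibleS _ _ _ _ (\bigcup_k S k)); last first.
  apply: negligible_bigcup => k; apply/negligibleP => //.
  apply/eqP; rewrite eq_le measure_ge0 andbT; apply/lee_addgt0Pr => e e0.
  by rewrite add0e; apply: h.
move=> w /= UV; have : 0 < `|U w - V w| by rewrite normr_gt0 subr_eq0; apply/eqP.
move=> p; have [k _ hk] := near_infty_natSinv_lt (PosNum p).
by exists k => //; rewrite /S /far /=; apply: hk => /=.
Qed.

Lemma cvg_iter_uniq n k (F : seq nat -> rvec n) L L' :
  (forall ms, size ms = k -> rvec_meas (F ms)) ->
  cvg_iter P k F L -> cvg_iter P k F L' -> {ae P, forall w, L w = L' w}.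
Proof.
move=> mF h h'; have mL := cvg_iter_meas mF h; have mL' := cvg_iter_meas mF h'.
apply: ae_eq_far => // e dlt e0 d0.
have e2 : 0 < e / 2 by rewrite divr_gt0.
have d2 : 0 < dlt / 2 by rewrite divr_gt0.
have [ms sz [c c']] := iev_ex (iev_and (cvg_iter_iev mF h e2 d2) (cvg_iter_iev mF h' e2 d2)).
rewrite [e]splitr [dlt]splitr; apply: far_leD (ltW e2) (ltW e2) _ (mF _ sz) _ _ c' => //.
by rewrite far_sym.
Qed.

Lemma cvg_iter_ext n k (F F' : seq nat -> @rvec R d T n) L :
  (forall ms, size ms = k -> F ms = F' ms) -> cvg_iter P k F L -> cvg_iter P k F' L.
Proof.
elim: k F F' L => [|k IH] F F' L h /=; first by move=> <-; rewrite h.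
move=> [Gs [hG hL]]; exists Gs; split => // M; apply: IH (hG M) => ms sz.
by apply: h; rewrite /= sz.
Qed.

(** [Lk ms] is the explicit intermediate limit once the coordinates from [size ms] on have gone to
    infinity; it suffices to remove the last coordinate each time. *)
Lemma cvg_iter_down n N (Lk : seq nat -> @rvec R d T n) :
  (forall ms, (size ms < N)%N -> cvg_prob P (fun M => Lk (rcons ms M)) (Lk ms)) ->
  forall k ms, (size ms + k = N)%N -> cvg_iter P k (fun ms' => Lk (ms ++ ms')) (Lk ms).
Proof.
move=> h; elim=> [|k IH] ms sz /=; first by rewrite cats0.
exists (fun M => Lk (rcons ms M)); split; last by apply: h; rewrite -sz addnS ltnS leq_addr.
move=> M; apply: cvg_iter_ext (IH (rcons ms M) _); last by rewrite size_rcons addSnnS.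
by move=> ms' _; rewrite cat_rcons.
Qed.

Lemma far_sum n (I : finType) (c : I -> R) (U V : I -> @rvec R d T n) (e dlt : R) :
  0 <= e -> (forall i, `|c i| <= 1) ->
  (forall i, rvec_meas (U i)) -> (forall i, rvec_meas (V i)) ->
  (forall i, (P (far e (U i) (V i)) <= dlt%:E)%E) ->
  (P (far (#|I|%:R * e) (fun w => (\sum_i c i *: U i w)%R) (fun w => (\sum_i c i *: V i w)%R))
    <= (#|I|%:R * dlt)%:E)%E.
Proof.
move=> e0 hc mU mV h.
have [mb Pb] := @bad_bound _ _ _ P _ _ U V (enum I) e dlt e0 mU mV (fun i _ => h i).
set b := [set w | _] in mb Pb; rewrite -cardE in Pb.
apply: le_trans Pb; apply: le_measure; rewrite ?inE //.
  apply: measurable_far; first by rewrite mulr_ge0.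
  - by apply: rvec_meas_sum => i; apply: rvec_meas_scale.
  - by apply: rvec_meas_sum => i; apply: rvec_meas_scale.
move=> w; rewrite /far /= -sumrB => hw; apply: contrapT => nb; move: hw.
rewrite ltNge => /negP; apply; apply: le_trans (ler_norm_sum _ _ _) _.
rewrite mulr_natl -sumr_const; apply: ler_sum => i _; rewrite -scalerBr normrZ.
have : `|U i w - V i w| <= e.
  by rewrite leNgt; apply/negP => hh; apply: nb; exists i => //; rewrite mem_enum.
by move=> hi; rewrite -[leRHS]mul1r; apply: ler_pM.
Qed.

Lemma cvg_prob_sum n (I : finType) (c : I -> R) (U : I -> nat -> @rvec R d T n) V :
  (forall i, `|c i| <= 1) -> (forall i m, rvec_meas (U i m)) ->
  (forall i, cvg_prob P (U i) (V i)) ->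
  cvg_prob P (fun m w => \sum_i c i *: U i m w) (fun w => \sum_i c i *: V i w).
Proof.
move=> hc mU h; have mV i : rvec_meas (V i) by case: (h i).
apply/cvg_probP => [m||e dlt e0 d0].
- by apply: rvec_meas_sum => i; apply: rvec_meas_scale.
- by apply: rvec_meas_sum => i; apply: rvec_meas_scale.
have N0 : 0 < #|I|.+1%:R :> R by rewrite ltr0n.
pose e' := e / #|I|.+1%:R; pose d' := dlt / #|I|.+1%:R.
have e'0 : 0 < e' by rewrite divr_gt0.
have d'0 : 0 < d' by rewrite divr_gt0.
have /fin_all_exists[K hK] i : exists K, forall m, (K <= m)%N ->
    (P (far e' (U i m) (V i)) <= d'%:E)%E.
  by have [K hK] := (cvg_probP (mU i) (mV i)).1 (h i) _ _ e'0 d'0; exists K.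
exists (\max_i K i)%N => m Km.
have le1 (x : R) : 0 < x -> #|I|%:R * (x / #|I|.+1%:R) <= x.
  move=> x0; rewrite mulrA ler_pdivrMr // mulrC ler_wpM2l ?(ltW x0) //.
  by rewrite ler_nat.
have := @far_sum _ _ c (fun i => U i m) V e' d' (ltW e'0) hc (fun i => mU i m) mV.
move=> /(_ (fun i => hK i m (leq_trans (leq_bigmax_cond (F := K) i isT) Km))) H.
apply: (@le_trans _ _ (#|I|%:R * d')%:E); last by rewrite lee_fin le1.
apply: le_trans H; apply: le_measure; rewrite ?inE.
- by apply: measurable_far (ltW e0) _ _; apply: rvec_meas_sum => i; apply: rvec_meas_scale.
- have e1 : 0 <= #|I|%:R * e' by rewrite mulr_ge0 // ltW.
  by apply: measurable_far e1 _ _; apply: rvec_meas_sum => i; apply: rvec_meas_scale.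
- by move=> w; rewrite /far /= => hw; apply: le_lt_trans hw; exact: le1.
Qed.

Lemma mulmx_norm_le n (A : 'M[R]_n) (v : 'cV[R]_n) :
  `|A *m v| <= (\sum_i \sum_j `|A i j|) * `|v|.
Proof.
apply/norm_leP => [|i].
  by rewrite mulr_ge0 //; do 2 apply: sumr_ge0 => ? _.
have vle := (norm_leP v (normr_ge0 v)).1 (le_refl _).
rewrite mxE; apply: le_trans (ler_norm_sum _ _ _) _.
apply: (@le_trans _ _ ((\sum_j `|A i j|) * `|v|)).
  rewrite mulr_suml; apply: ler_sum => j _; rewrite normrM.
  by apply: ler_wpM2l.
rewrite ler_wpM2r // [leRHS](bigD1 i) //= lerDl.
by do 2 apply: sumr_ge0 => ? _.
Qed.

(** A single random vector is tight: off an event of small probability its norm is at most some K,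
    and there the product is at most K times the norm of the deterministic matrix. *)
Lemma mulmx_cvg0 n (A : nat -> 'M[R]_n) (U : @rvec R d T n) : rvec_meas U ->
  (forall i j, (fun m => A m i j) @ \oo --> (0 : R)) ->
  forall e dlt : R, 0 < e -> 0 < dlt ->
  eventually_nat (fun m => (P (far e (fun w => (A m *m U w)%R) (fun=> 0%R)) <= dlt%:E)%E).
Proof.
move=> mU hA e dlt e0 d0.
pose S k := far k%:R U (fun=> 0).
have m0 : rvec_meas (fun _ : T => 0 : 'cV[R]_n) := @rvec_meas0 _ _ _ _.
have mS k : measurable (S k) by apply: measurable_far.
have cS : \bigcap_k S k = set0.
  apply/seteqP; split=> w // hw.
  have := hw (Num.bound `|U w|) Logic.I; rewrite /S /far /= subr0 ltNge => /negP; apply.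
  by apply/ltW/archi_boundP.
have : (P \o S) @ \oo --> P (\bigcap_k S k).
  apply: nonincreasing_cvg_mu => //.
  - by rewrite ltey_eq fin_num_measure.
  - by rewrite cS.
  - move=> k l kl; apply/subsetPset => w; rewrite /S /far /= => hw; apply: le_lt_trans hw.
    by rewrite ler_nat.
rewrite cS measure0 => /(prob_cvg0P mS) /(_ dlt d0)[K /(_ K (leqnn K)) hK].
pose c m := \sum_i \sum_j `|A m i j|.
have c0 : c @ \oo --> (0 : R).
  have -> : (0 : R) = \sum_(i < n) \sum_(j < n) 0 by rewrite big1 // => i _; rewrite big1.
  apply: cvg_sumr => i; apply: cvg_sumr => j; apply/norm_cvg0P; exact: hA.
(* The successor handles K = 0. *)
have eK : 0 < e / K.+1%:R by rewrite divr_gt0 ?ltr0n.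
have /cvgrPdist_le/(_ _ eK)/near_eventually[M hM] := c0.
exists M => m /hM; rewrite sub0r normrN => hc.
apply: le_trans hK; apply: le_measure; rewrite ?inE //.
  by apply: measurable_far (ltW e0) _ m0; apply: rvec_meas_mulmx.
move=> w; rewrite /S /far /= !subr0 => h; rewrite ltNge; apply/negP => hU.
move: h; rewrite ltNge => /negP; apply.
apply: le_trans (mulmx_norm_le _ _) _.
apply: (@le_trans _ _ (e / K.+1%:R * K%:R)).
  apply: ler_pM => //; first by do 2 apply: sumr_ge0 => ? _.
  by apply: le_trans hc; exact: ler_norm.
by rewrite mulrAC ler_pdivrMr ?ltr0n // ler_wpM2l ?(ltW e0) // ler_nat.
Qed.

End Convergence.

(** * Box sums of increments *)

Lemma tensor_sum_congr (K : comNzRingType) (V : lmodType K) (N : nat) (A : finType)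
    (a : 'I_N -> A -> K) (p : 'I_N -> A -> int) (Z Z' : ('I_N -> int) -> V) :
  (forall f : 'I_N -> A, Z (fun l => p l (f l)) = Z' (fun l => p l (f l))) ->
  tensor_sum a p Z = tensor_sum a p Z'.
Proof. by move=> h; apply: eq_bigr => f _; rewrite (h f). Qed.

Lemma centered_sum (K : comNzRingType) m (c : int -> K) (x : int) :
  ((m < absz x)%N -> c x = 0) ->
  \sum_(y < (m + m).+1) c (centered y) * (centered y == x)%:R = c x.
Proof.
move=> h; case: (leqP (absz x) m) => [/centered_surj[y <-]|mx].
  rewrite (bigD1 y) //= eqxx mulr1 big1 ?addr0 // => z zy.
  by case: eqP => [/centered_inj e|_]; rewrite ?mulr0 //; rewrite e eqxx in zy.
rewrite h // big1 // => y _; case: eqP => [e|_]; last by rewrite mulr0.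
by have := ltn_ord y; move: e mx; rewrite /centered; lia.
Qed.

(** One window serves boxes with different bounds. This fixed index type is what [tensor_sum_Delta]
    requires when the bounds vary with s. *)
Lemma box_sum_centered (K : comNzRingType) (V : lmodType K) (N : nat) m (lo hi : 'I_N -> int)
    (F : ('I_N -> int) -> V) :
  (forall l, (absz (lo l) <= m)%N /\ (absz (hi l) <= m)%N) ->
  box_sum lo hi F = tensor_sum (fun l (y : 'I_(m + m).+1) => ((lo l <= centered y) && (centered y <= hi l))%R%:R)
     (fun=> @centered m) F.
Proof.
move=> h; apply: box_sumP => l x.
apply: (centered_sum (c := fun x => ((lo l <= x) && (x <= hi l))%R%:R)).
have [h1 h2] := h l => mx; case: (boolP (_ && _)) => // /andP[]; lia.
Qed.

Lemma bound_ex N (f : 'I_N -> int) : exists m, forall l, (absz (f l) <= m)%N.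
Proof.
exists (\max_l absz (f l))%N => l; exact: (leq_bigmax_cond (F := fun l => absz (f l))).
Qed.

Lemma box_sum_shift (K : comNzRingType) (V : lmodType K) (N : nat) (lo hi s : 'I_N -> int)
    (F : ('I_N -> int) -> V) :
  box_sum lo hi (fun j => F (addt j s)) = box_sum (addt lo s) (addt hi s) F.
Proof.
have [W [hW ->]] := box_sum_tensor lo hi (fun j => F (addt j s)).
rewrite (box_sumP (a := fun l (y : 'I_W.+1) => (lo l + (y : nat)%:Z <= hi l)%R%:R)
  (p := fun l y => lo l + (y : nat)%:Z + s l)) // => l x.
transitivity (((lo l <= x - s l) && (x - s l <= hi l))%R%:R : K).
  rewrite -(indicator_itv_sum K (x - s l) (hW l)); apply: eq_bigr => y _; congr (_ * (_ : bool)%:R).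
  by apply/eqP/eqP; lia.
by congr (nat_of_bool _)%:R; rewrite /addt; lia.
Qed.

Lemma box_sum_clip (K : comNzRingType) (V : lmodType K) (N : nat) (lo hi : 'I_N -> int)
    (F : ('I_N -> int) -> V) :
  box_sum lo hi F = box_sum (fun l => Num.min (lo l) (hi l + 1)) hi F.
Proof.
have [W [hW ->]] := box_sum_tensor lo hi F.
apply/esym/box_sumP => l x; rewrite indicator_itv_sum //.
congr (_%:R); congr nat_of_bool; lia.
Qed.

(** In one coordinate, the indicators of [lo, t] and [lo, t - 1] differ by that of the point t as
    soon as lo <= t. *)
Lemma Delta_box_sum (K : comNzRingType) (V : lmodType K) (N : nat) (lo t : 'I_N -> int)
    (F : ('I_N -> int) -> V) : (forall l, lo l <= t l) ->
  tensor_sum (fun l => @bsgn K) (fun l (b : bool) => t l - (b : nat)%:Z) (fun s => box_sum lo s F) = F t.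
Proof.
move=> lot; have [m1 h1] := bound_ex lo; have [m2 h2] := bound_ex t.
(* The extra unit makes room for the upper bounds [t l - 1]. *)
pose m := (m1 + m2).+1.
pose b (l : 'I_N) (x : int) (y : 'I_(m + m).+1) : K := ((lo l <= centered y) && (centered y <= x))%R%:R.
transitivity (tensor_sum (fun l => @bsgn K) (fun l (b : bool) => t l - (b : nat)%:Z)
   (fun s => tensor_sum (fun l => b l (s l)) (fun l => (fun=> @centered m) (s l)) F)).
  apply: tensor_sum_congr => f; apply: box_sum_centered => l.
  by have := h1 l; have := h2 l; case: (f l); rewrite /m /=; lia.
rewrite (tensor_sum_Delta (b := b) (q := fun l x => @centered m)) // => l x.
rewrite /b !(centered_sum (c := fun z => ((lo l <= z) && (z <= _))%R%:R)).
- have := lot l; case: (boolP (lo l <= x)); case: (boolP (x <= t l)); case: (boolP (x <= t l - 1));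
    case: eqP => /=; rewrite ?subr0 ?subrr //; lia.
- have := h1 l; have := h2 l; rewrite /m; case: (boolP (_ && _)) => // /andP[]; lia.
- have := h1 l; have := h2 l; rewrite /m; case: (boolP (_ && _)) => // /andP[]; lia.
Qed.

Definition Mlo N (t : 'I_N -> int) : 'I_N -> int := fun l => if 0 <= t l then 1 else t l + 1.
Definition Mhi N (t : 'I_N -> int) : 'I_N -> int := fun l => if 0 <= t l then t l else 0.

Lemma Mtheta_sign (K : comNzRingType) N (t : 'I_N -> int) :
  (-1) ^+ #|[set l : 'I_N | t l < 0]| = \prod_l @bsgn K (t l < 0).
Proof.
rewrite -prodr_const big_mkcond /=; apply: eq_bigr => l _.
rewrite /bsgn; case: ifPn; rewrite ?inE /=.
  by move=> ->.
by rewrite notin_setE /= => /negP/negbTE ->.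
Qed.

(** The signed indicator is the oriented interval from 0 to t. The orientation makes its increment a
    unit mass at t across the sign change as well. *)
Lemma signed_box_diff (K : comNzRingType) (t x : int) :
  bsgn K (t < 0) * (((if 0 <= t then 1 else t + 1) <= x) && (x <= (if 0 <= t then t else 0)))%R%:R
  - bsgn K (t - 1 < 0) * (((if 0 <= t - 1 then 1 else t - 1 + 1) <= x) &&
       (x <= (if 0 <= t - 1 then t - 1 else 0)))%R%:R = (t == x)%:R.
Proof.
rewrite /bsgn; have [ha|ha] := leP 0 t; have [hb|hb] := leP 0 (t - 1);
  rewrite ?expr0 ?expr1 ?mul1r ?mulN1r ?opprK; try (exfalso; lia);
  case: (boolP (_ && _)) => h1; case: (boolP (_ && _)) => h2; case: (boolP (t == x)) => h3 /=;
  rewrite ?oppr0 ?subr0 ?subrr ?add0r ?addr0 ?addNr //; exfalso; move: h1 h2 h3 ha hb; clear; lia.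
Qed.

Lemma Delta_signed_box (K : comNzRingType) (V : lmodType K) (N : nat) (t : 'I_N -> int)
    (F : ('I_N -> int) -> V) :
  tensor_sum (fun l => @bsgn K) (fun l (b : bool) => t l - (b : nat)%:Z)
    (fun s => (\prod_l @bsgn K (s l < 0)) *: box_sum (Mlo s) (Mhi s) F) = F t.
Proof.
(* Both [t l] and [t l - 1] must lie strictly inside the window for [z0] below. *)
have [m0 h0] := bound_ex t; pose m := (m0 + 2)%N.
pose c (x z : int) : K := bsgn K (x < 0) *
  ((((if 0 <= x then 1 else x + 1) <= z) && (z <= (if 0 <= x then x else 0)))%R%:R).
pose b (l : 'I_N) (x : int) (y : 'I_(m + m).+1) : K := c x (centered y).
transitivity (tensor_sum (fun l => @bsgn K) (fun l (b : bool) => t l - (b : nat)%:Z)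
   (fun s => tensor_sum (fun l => b l (s l)) (fun l => (fun=> @centered m) (s l)) F)).
  apply: tensor_sum_congr => f; rewrite (box_sum_centered (m := m)).
    rewrite /tensor_sum scaler_sumr; apply: eq_bigr => g _; rewrite scalerA -big_split.
    by congr (_ *: _).
  by move=> l; rewrite /Mlo /Mhi; have := h0 l; case: (f l) => /= ?; case: ifP; rewrite /m; lia.
rewrite (tensor_sum_Delta (b := b) (q := fun l x => @centered m)) // => l x.
have z0 u : (absz u < m)%N -> (m < absz x)%N -> c u x = 0.
  move=> um mx; rewrite /c; case: (boolP (_ && _)) => [/andP[h1 h2]|_]; last by rewrite mulr0.
  by exfalso; move: h1 h2; case: ifP; lia.
rewrite /b !(centered_sum (c := c _)); first last.
- by apply: z0; have := h0 l; rewrite /m; lia.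
- by apply: z0; have := h0 l; rewrite /m; lia.
exact: signed_box_diff.
Qed.

(** * The homomorphism t -> exp(t * Theta) on Z^N *)

Section Exponential.
Context {R : realType} (N n : nat) (Theta : 'I_N -> 'M[R]_n).
Context (symT : forall j, symmetric_mx (Theta j)).
Context (posT : forall j, posdef_mx (Theta j)).
Context (comT : forall i j, Theta i *m Theta j = Theta j *m Theta i).

Definition negt (t : 'I_N -> int) : 'I_N -> int := fun l => - t l.
Definition unit_t (k : 'I_N) (m : int) : 'I_N -> int := fun l => if l == k then m else 0.

Lemma tstarD t s : tstar (addt t s) Theta = tstar t Theta + tstar s Theta.
Proof.
by rewrite /tstar -big_split /=; apply: eq_bigr => j _; rewrite /addt intrD scalerDl.
Qed.

Lemma tstarN t : tstar (negt t) Theta = - tstar t Theta.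
Proof.
by rewrite /tstar -sumrN; apply: eq_bigr => j _; rewrite /negt intrN scaleNr.
Qed.

Lemma tstar_unit k m : tstar (unit_t k m) Theta = m%:~R *: Theta k.
Proof.
rewrite /tstar (bigD1 k) //= /unit_t eqxx big1 ?addr0 // => j jk.
by rewrite (negbTE jk) scale0r.
Qed.

Lemma tstarC t s : tstar t Theta *m tstar s Theta = tstar s Theta *m tstar t Theta.
Proof.
rewrite /tstar mulmx_suml mulmx_sumr; apply: eq_bigr => i _.
rewrite mulmx_suml mulmx_sumr; apply: eq_bigr => j _.
by rewrite -!scalemxAl -!scalemxAr comT !scalerA mulrC.
Qed.

Definition exp_star (t : 'I_N -> int) := mexp (tstar t Theta).
Local Notation E := exp_star.

Lemma exp_starD t s : E (addt t s) = E t *m E s.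
Proof. by rewrite /exp_star tstarD mexpD // tstarC. Qed.

Lemma exp_starN t : mexp (- tstar t Theta) = E (negt t).
Proof. by rewrite /exp_star tstarN. Qed.

Lemma exp_star0 : E (fun=> 0) = 1%:M.
Proof. by rewrite /exp_star /tstar big1 ?mexp0 // => j _; rewrite scale0r. Qed.

Lemma exp_starK t : E (negt t) *m E t = 1%:M.
Proof. by rewrite -exp_starD -exp_star0; congr E; apply: funext => l; rewrite /addt addNr. Qed.

Lemma exp_starKV t : E t *m E (negt t) = 1%:M.
Proof. by rewrite -exp_starD -exp_star0; congr E; apply: funext => l; rewrite /addt addrN. Qed.

Lemma exp_star_decay k i j : (fun m : nat => E (unit_t k (- m%:Z)) i j) @ \oo --> (0 : R).
Proof.
have := @mexp_decay R n (Theta k) i j (symT k) (posT k).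
rewrite (_ : (fun m => _) = (fun m : nat => E (unit_t k (- m%:Z)) i j)) //.
by apply: funext => m; rewrite /exp_star tstar_unit intrN scaleNr.
Qed.

End Exponential.

(** * The Lamperti transformations *)

Section DeltaAlgebra.
Context {R : realType} {d : measure_display} {T : measurableType d}.

Lemma Delta_addt N n (X : @field R d T N n) t s w :
  Delta (fun u => X (addt u s)) t w = Delta X (addt t s) w.
Proof.
apply: eq_bigr => b _; congr (_ *: X _ w); apply: funext => l; rewrite /addt; lia.
Qed.

Lemma Delta_mulmx N n (A : 'M[R]_n) (X : @field R d T N n) t w :
  Delta (fun u w => A *m X u w) t w = A *m Delta X t w.
Proof. by rewrite /Delta mulmx_sumr; apply: eq_bigr => b _; rewrite scalemxAr. Qed.

Lemma Delta_coord N n (X : @field R d T N n) t w :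
  Delta (@coord_field R N n) t (coords X w) = Delta X t w.
Proof. by apply: eq_bigr => b _; rewrite coord_fieldE. Qed.

Lemma box_sum_mulmx N n (A : 'M[R]_n) lo hi (F : ('I_N -> int) -> 'cV[R]_n) :
  box_sum lo hi (fun j => A *m F j) = A *m box_sum lo hi F.
Proof. by rewrite /box_sum mulmx_sumr. Qed.

Lemma bsgn_norm (b : bool) : `|@bsgn R b| = 1.
Proof. by case: b; rewrite /bsgn ?expr0 ?expr1 ?normrN ?normr1. Qed.

Lemma prod_bsgn_norm (I : finType) (b : I -> bool) : `|\prod_i @bsgn R (b i)| = 1.
Proof. by rewrite normr_prod big1 // => i _; exact: bsgn_norm. Qed.

End DeltaAlgebra.

Section Lamperti.
Context {R : realType} {d : measure_display} {T : measurableType d} (P : probability T R).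
Context (N n : nat) (Theta : 'I_N -> 'M[R]_n).
Context (symT : forall j, symmetric_mx (Theta j)).
Context (posT : forall j, posdef_mx (Theta j)).
Context (comT : forall i j, Theta i *m Theta j = Theta j *m Theta i).
Local Notation E := (exp_star Theta).

Lemma MthetaE (Y : @field R d T N n) t w :
  Mtheta Theta Y t w = (\prod_l @bsgn R (t l < 0)) *:
    box_sum (Mlo t) (Mhi t) (fun j => E (negt j) *m Delta Y j w).
Proof.
rewrite /Mtheta Mtheta_sign; congr (_ *: box_sum _ _ _).
by apply: funext => j; rewrite exp_starN.
Qed.

Lemma Delta_Mtheta (Y : @field R d T N n) t w :
  Delta (Mtheta Theta Y) t w = E (negt t) *m Delta Y t w.
Proof.
rewrite DeltaE -(Delta_signed_box t (fun j => E (negt j) *m Delta Y j w)).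
by apply: tensor_sum_congr => f; rewrite MthetaE.
Qed.

Lemma Mtheta_field (Y : @field R d T N n) : is_field Y -> is_field (Mtheta Theta Y).
Proof.
move=> mY t; apply: rvec_meas_scale; apply: box_sum_meas => j.
by apply: rvec_meas_mulmx; apply: Delta_meas.
Qed.

Lemma Minv_partial_meas (G : @field R d T N n) t ms :
  is_field G -> rvec_meas (Minv_partial Theta G t ms).
Proof.
move=> mG; apply: (box_sum_meas _ _ (X := fun j w => mexp (tstar j Theta) *m Delta G j w)) => j.
by apply: rvec_meas_mulmx; apply: Delta_meas.
Qed.

Lemma self_similar_law (Y : @field R d T N n) s : self_similar P Theta Y ->
  law_eq P (coords (fun t => Y (addt t s))) (coords (fun t w => E s *m Y t w)).
Proof.
move=> [mY h]; apply: eq_fdd_law (h s) => t; first exact: mY.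
by apply: rvec_meas_mulmx; exact: mY.
Qed.

Lemma stationary_Mtheta (Y : @field R d T N n) : self_similar P Theta Y ->
  stationary_increments P (Mtheta Theta Y).
Proof.
move=> sY s; apply: law_eq_fdd.
(* One functional is applied to both sides: it sends the shifted Y to the increment at t + s, and
   [E s *m Y] to the increment at t. *)
apply: (law_op (Psi := fun t x => E (negt (addt t s)) *m Delta (@coord_field R N n) t x))
   (self_similar_law s sY) _ _ => t.
- by apply: rvec_meas_mulmx; apply: Delta_meas => u; exact: coord_field_meas.
- by move=> w; rewrite Delta_Mtheta Delta_coord Delta_addt.
- move=> w; rewrite Delta_Mtheta Delta_coord Delta_mulmx mulmxA -exp_starD //; congr (E _ *m _).
  by apply: funext => l; rewrite /addt /negt; lia.
Qed.

(* Lowering the lower bound to t_l + 1 when the box is empty keeps it empty and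
   makes the telescoping formula valid. *)
Definition corner (t : 'I_N -> int) (ms : seq nat) (l : 'I_N) (b : bool) : int :=
  if b then Num.min (- (nth 0%N ms l)%:Z) (t l + 1) - 1 else t l.

Lemma Minv_partial_Mtheta (Y : @field R d T N n) t ms w :
  Minv_partial Theta (Mtheta Theta Y) t ms w =
  tensor_sum (fun l => @bsgn R) (corner t ms) (fun s => Y s w).
Proof.
rewrite /Minv_partial; under [F in box_sum _ _ F]funext => j.
  rewrite Delta_Mtheta mulmxA -/(E j) exp_starKV // mul1mx DeltaE.
  over.
rewrite box_sum_clip box_sum_telescope // => l; lia.
Qed.

Lemma self_similar_decay (Y : @field R d T N n) u0 k : self_similar P Theta Y ->
  forall e dlt : R, 0 < e -> 0 < dlt ->
  eventually_nat (fun m =>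
    (P (far e (Y (addt u0 (unit_t k (- m%:Z)))) (fun=> 0%R)) <= dlt%:E)%E).
Proof.
move=> sY e dlt e0 d0; have mY := sY.1.
have mB : measurable (far e (@coord_field R N n u0) (fun=> 0)).
  by apply: measurable_far (ltW e0) _ _; [exact: coord_field_meas|exact: rvec_meas0].
have pre (X : @field R d T N n) :
    coords X @^-1` far e (@coord_field R N n u0) (fun=> 0) = far e (X u0) (fun=> 0).
  by apply: funext => w; rewrite /far /preimage /= coord_fieldE.
have [K hK] := mulmx_cvg0 P (A := fun m : nat => E (unit_t k (- m%:Z))) (mY u0)
  (fun i j => exp_star_decay symT posT k i j) e0 d0.
exists K => m /hK; have := self_similar_law (unit_t k (- m%:Z)) sY mB.
by rewrite !pre => ->.
Qed.

(* The partial sum after the limits in the coordinates l >= size ms: the corners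
   that went to minus infinity in one of them have disappeared. *)
Definition limit_stage (Y : @field R d T N n) t (ms : seq nat) : @rvec R d T n :=
  fun w => \sum_(b : {ffun 'I_N -> bool}) (\prod_l @bsgn R (b l)) *:
    (if [exists l : 'I_N, (size ms <= l)%N && b l] then fun=> 0
     else Y (fun l => corner t ms l (b l))) w.

Lemma limit_stage_full (Y : @field R d T N n) t ms : size ms = N ->
  limit_stage Y t ms = Minv_partial Theta (Mtheta Theta Y) t ms.
Proof.
move=> sz; apply: funext => w; rewrite Minv_partial_Mtheta; apply: eq_bigr => b _.
case: existsP => // -[l /andP[]]; by rewrite sz leqNgt ltn_ord.
Qed.

Lemma limit_stage_nil (Y : @field R d T N n) t : limit_stage Y t [::] = Y t.
Proof.
apply: funext => w; rewrite /limit_stage (bigD1 [ffun=> false]) //= [X in _ + X]big1 ?addr0.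
  case: existsP => [[l h]|_]; first by rewrite ffunE in h.
  rewrite big1 => [|l _]; last by rewrite ffunE.
  by rewrite scale1r; congr (Y _ w); apply: funext => l; rewrite ffunE.
move=> b bn; case: existsP => [|nb]; first by rewrite scaler0.
case/eqP: bn; apply/ffunP => l; rewrite ffunE; apply/negbTE/negP => bl.
by apply: nb; exists l; rewrite bl.
Qed.

Lemma limit_stage_cvg (Y : @field R d T N n) t ms : self_similar P Theta Y ->
  (size ms < N)%N -> cvg_prob P (fun M => limit_stage Y t (rcons ms M)) (limit_stage Y t ms).
Proof.
move=> sY szN; have mY := sY.1.
(* The threshold k is separated from the tuple so that both stages have the same form, and the limit
   can be taken for each corner b separately. *)
pose sel k (ms : seq nat) (b : {ffun 'I_N -> bool}) : @rvec R d T n :=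
  if [exists l : 'I_N, (k <= l)%N && b l] then fun=> 0
     else Y (fun l => corner t ms l (b l)).
have msel k ms' b : rvec_meas (sel k ms' b).
  by rewrite /sel; case: ifP => _; [exact: rvec_meas0|exact: mY].
suff H b : cvg_prob P (fun M => sel (size ms).+1 (rcons ms M) b) (sel (size ms) ms b).
  rewrite (_ : (fun M => limit_stage Y t (rcons ms M)) = (fun M w => \sum_(b : {ffun 'I_N -> bool})
     (\prod_l @bsgn R (b l)) *: sel (size ms).+1 (rcons ms M) b w)).
    by apply: cvg_prob_sum => // b'; rewrite prod_bsgn_norm.
  by apply: funext => M; apply: funext => w; rewrite /limit_stage size_rcons.
apply/cvg_probP => // e dlt e0 d0.
have triv M : sel (size ms).+1 (rcons ms M) b = sel (size ms) ms b ->
    (P (far e (sel (size ms).+1 (rcons ms M) b) (sel (size ms) ms b)) <= dlt%:E)%E.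
  by move=> ->; rewrite far_refl ?(ltW e0) // measure0 lee_fin ltW.
pose k := Ordinal szN.
(* A later coordinate already sits at its lower end, so both stages are 0. *)
case: (boolP [exists l : 'I_N, ((size ms).+1 <= l)%N && b l]) => [h1|h1].
  exists 0%N => M _; apply: triv; rewrite /sel h1; case: ifP => // /negbT/negP[].
  by case/existsP: h1 => l /andP[/ltnW h2 bl]; apply/existsP; exists l; rewrite h2.
have small l : b l -> (l <= size ms)%N.
  move=> bl; rewrite leqNgt; apply: contra h1 => h2.
  by apply/existsP; exists l; rewrite h2.
(* At the upper end of coordinate k the corner does not involve M, so both stages coincide. *)
case: (boolP (b k)) => bk; last first.
  exists 0%N => M _; apply: triv; rewrite /sel (negbTE h1) /=.
  case: (boolP [exists l : 'I_N, (size ms <= l)%N && b l]) => [/existsP[l /andP[h2 bl]]|_].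
    have lk : l = k by apply: val_inj => /=; apply/eqP; rewrite eqn_leq h2 small.
    by rewrite -lk bl in bk.
  congr Y; apply: funext => l; rewrite /corner; case: ifP => // bl.
  rewrite nth_rcons; have := small l bl; rewrite leq_eqVlt => /orP[/eqP e1|->//].
  have lk : l = k by exact: val_inj.
  by rewrite -lk bl in bk.
pose u0 := fun l => if l == k then 0 else corner t ms l (b l).
have [K hK] := self_similar_decay u0 k sY e0 d0.
(* For M > |t_k| the minimum in [corner] is -M, so the corner has coordinate -(M + 1); this explains
   [M.+1] below. *)
exists (maxn K (absz (t k)).+1) => M; rewrite geq_max => /andP[KM tM].
rewrite {1}/sel (negbTE h1).
have -> : sel (size ms) ms b = fun=> 0.
  by rewrite /sel; case: existsP => // -[]; exists k; rewrite /= leqnn.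
have := hK M.+1 (leq_trans KM (leqnSn _)).
congr (P (far e (Y _) _) <= _)%E; apply: funext => l.
rewrite /addt /u0 /unit_t; case: (eqVneq l k) => [->|lk].
  by rewrite bk /corner nth_rcons ltnn eqxx; lia.
rewrite addr0 /corner; case: ifP => // bl; rewrite nth_rcons.
have := small l bl; rewrite leq_eqVlt => /orP[/eqP e1|->//].
by case/eqP: lk; exact: val_inj.
Qed.

Lemma Minv_Mtheta_cvg (Y : @field R d T N n) t : self_similar P Theta Y ->
  cvg_iter P N (Minv_partial Theta (Mtheta Theta Y) t) (Y t).
Proof.
move=> sY; have := cvg_iter_down (fun ms => @limit_stage_cvg Y t ms sY) (ms := [::]) (add0n N).
rewrite limit_stage_nil; apply: cvg_iter_ext => ms sz /=.
exact: limit_stage_full.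
Qed.

Lemma Mtheta_GTheta0 (Y : @field R d T N n) : self_similar P Theta Y ->
  GTheta0 P Theta (Mtheta Theta Y).
Proof.
move=> sY; split; first split; first exact: Mtheta_field sY.1.
  split; first exact: stationary_Mtheta.
  by move=> t; exists (Y t); exact: Minv_Mtheta_cvg.
(* A zero coordinate has the empty range from 1 to 0, so the value is 0 surely. *)
move=> t [l tl]; apply: aeW => w.
rewrite /Mtheta /box_sum big_pred0 ?scaler0 // => f; apply/negbTE.
by rewrite negb_forall; apply/existsP; exists l; rewrite tl lexx; lia.
Qed.

Lemma MinvP (G : @field R d T N n) t : Minv_converges P Theta G t ->
  cvg_iter P N (Minv_partial Theta G t) (Minv P Theta G t).
Proof. by rewrite /Minv; case: pselect => // h _; exact: projT2 (cid h). Qed.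

Lemma Minv_Mtheta (Y : @field R d T N n) t : self_similar P Theta Y ->
  {ae P, forall w, Minv P Theta (Mtheta Theta Y) t w = Y t w}.
Proof.
move=> sY; have c := Minv_Mtheta_cvg t sY.
apply: (cvg_iter_uniq _ (MinvP (ex_intro _ _ c)) c) => ms _.
by apply: Minv_partial_meas; exact: Mtheta_field sY.1.
Qed.

End Lamperti.

(** * The inverse transformation on stationary increment fields *)

Section InverseLamperti.
Context {R : realType} {d : measure_display} {T : measurableType d} (P : probability T R).
Context (N n : nat) (Theta : 'I_N -> 'M[R]_n).
Context (comT : forall i j, Theta i *m Theta j = Theta j *m Theta i).
Local Notation E := (exp_star Theta).

Lemma Minv_field (G : @field R d T N n) : GTheta P Theta G -> is_field (Minv P Theta G).
Proof.
move=> [mG [_ cG]] t; apply: cvg_iter_meas (MinvP (cG t)) => ms _.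
exact: Minv_partial_meas.
Qed.

Lemma Minv_iev (G : @field R d T N n) t (e dlt : R) : GTheta P Theta G ->
  0 < e -> 0 < dlt ->
  iev N (fun ms => (P (far e (Minv_partial Theta G t ms) (Minv P Theta G t)) <= dlt%:E)%E).
Proof.
move=> [mG [_ cG]] e0 d0; apply: cvg_iter_iev (MinvP (cG t)) _ _ e0 d0 => ms _.
exact: Minv_partial_meas.
Qed.

Lemma far_mulmx (A : 'M[R]_n) : exists2 c : R, 0 < c &
  forall (e : R) (U V : @rvec R d T n), 0 < e ->
    far e (fun w => A *m U w) (fun w => A *m V w) `<=` far (e / c) U V.
Proof.
have s0 : 0 <= \sum_i \sum_j `|A i j| by do 2 apply: sumr_ge0 => ? _.
exists (\sum_i \sum_j `|A i j| + 1); first by rewrite ltr_wpDl.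
move=> e U V e0 w; rewrite /far /= -mulmxBr => h.
rewrite ltr_pdivrMr ?ltr_wpDl //; apply: lt_le_trans h _.
apply: le_trans (mulmx_norm_le _ _) _; rewrite mulrC ler_wpM2l //.
by rewrite lerDl.
Qed.

(* The index l of an iterated limit is a nat; the value for l >= N is irrelevant. *)
Definition shift_index (s : 'I_N -> int) (l M : nat) : nat :=
  if insub l is Some i then absz (M%:Z + s i) else M.

(** Substituting j + s for j moves the lower bound -M_l to -(M_l + s_l). The bound on |s_l| makes
    M_l + s_l nonnegative, so the absolute value in [shift_index] changes nothing. *)
Lemma Minv_partial_shift (G : @field R d T N n) s t ms w : size ms = N ->
  (forall l : 'I_N, (absz (s l) <= nth 0%N ms l)%N) ->
  Minv_partial Theta G (addt t s) ms w =
  E s *m box_sum (fun l => - (nth 0%N (map_index (shift_index s) ms) l)%:Z) t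
    (fun j => E j *m Delta G (addt j s) w).
Proof.
move=> sz hs; rewrite -box_sum_mulmx /Minv_partial.
have -> : (fun j => E s *m (E j *m Delta G (addt j s) w)) =
   (fun j => (fun u => E u *m Delta G u w) (addt j s)).
  apply: funext => j; rewrite mulmxA -exp_starD //; congr (E _ *m _).
  by apply: funext => l; rewrite /addt addrC.
rewrite (box_sum_shift _ t s (fun u => E u *m Delta G u w)); congr (box_sum _ _ _); apply: funext => l.
rewrite /addt nth_map_index ?sz // /shift_index insubT //= => lN.
rewrite (_ : Sub _ _ = l); last exact: val_inj.
by have := hs l; lia.
Qed.

Lemma Minv_self_similar (G : @field R d T N n) : GTheta P Theta G ->
  self_similar P Theta (Minv P Theta G).
Proof.
move=> hG; have mY := Minv_field hG; have [mG [stG cG]] := hG.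
split => // s; apply: law_eq_fdd.
have [c c0 hc] := far_mulmx (E s).
have mEY : is_field (fun t w => E s *m Minv P Theta G t w).
  by move=> t; apply: rvec_meas_mulmx.
apply: law_approx => // S e dlt e0 d0.
have ec : 0 < e / c by rewrite divr_gt0.
have [B hB] := bound_ex s.
(* A common tuple is sought: it approximates at t + s, its shift approximates at t within e / c to
   allow for [E s], and it exceeds every |s_l|. *)
have ev1 := iev_forall (s := S) (fun t _ => Minv_iev (addt t s) hG e0 d0).
have ev2 := iev_map_index (phi := shift_index s) _
   (iev_forall (s := S) (fun t _ => Minv_iev t hG ec d0)).
have [l K|ms sz [[h1 h2] h3]] := iev_ex (iev_and (iev_and ev1 (ev2 _)) (iev_ge N B)).
  rewrite /shift_index; case: insubP => [i _ _|_]; last by exists K.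
  by exists (K + B)%N => M; have := hB i; lia.
pose ms' := map_index (shift_index s) ms.
exists (fun t => Minv_partial Theta G (addt t s) ms).
exists (fun t w => E s *m Minv_partial Theta G t ms' w).
have mW : is_field (fun t w => E s *m Minv_partial Theta G t ms' w).
  by move=> t; apply: rvec_meas_mulmx; exact: Minv_partial_meas.
have mV : is_field (fun t => Minv_partial Theta G (addt t s) ms).
  by move=> t; exact: Minv_partial_meas.
split => //; last first.
  move=> t tS; split; first by rewrite far_sym; exact: h1.
  apply: le_trans (h2 t tS); apply: le_measure; rewrite ?inE.
  - exact: (measurable_far (ltW e0) (mEY t) (mW t)).
  - by apply: measurable_far (ltW ec) _ _; [exact: Minv_partial_meas|exact: mY].
  - by rewrite [X in _ `<=` X]far_sym; exact: hc.
(* Both approximations are one functional of the increments of G, shifted by s on one side;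
   stationarity equates their laws. *)
have L := eq_fdd_law _ _ (stG s).
apply: (law_op (Psi := fun t x => E s *m box_sum (fun l => - (nth 0%N ms' l)%:Z) t
    (fun j => E j *m @coord_field R N n j x))) (L _ _) _ _.
- move=> t; apply: rvec_meas_mulmx.
  apply: (box_sum_meas _ _ (X := fun j x => E j *m coord_field j x)) => j.
  by apply: rvec_meas_mulmx; exact: coord_field_meas.
- by move=> t; exact: Delta_meas.
- by move=> t; exact: Delta_meas.
- move=> t w; rewrite Minv_partial_shift // => [|l]; last exact: leq_trans (hB l) (h3 l (ltn_ord l)).
  by congr (_ *m box_sum _ _ _); apply: funext => j; rewrite coord_fieldE.
- move=> t w; rewrite /Minv_partial; congr (_ *m box_sum _ _ _).
  by apply: funext => j; rewrite coord_fieldE.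
Qed.

(** At a tuple common to the 2^N points t - b, with all lower bounds below t, the increment of the
    partial sums is exactly [E t *m Delta G t]; only the approximation errors remain. *)
Lemma Delta_Minv (G : @field R d T N n) t : GTheta P Theta G ->
  {ae P, forall w, Delta (Minv P Theta G) t w = E t *m Delta G t w}.
Proof.
move=> hG; have mY := Minv_field hG; have [mG _] := hG.
have mD : rvec_meas (fun w => E t *m Delta G t w) by apply: rvec_meas_mulmx; exact: Delta_meas.
apply: ae_eq_far => // [|e dlt e0 d0]; first exact: Delta_meas.
pose I := {ffun 'I_N -> bool}.
have I0 : 0 < #|I|%:R :> R.
  by rewrite ltr0n; apply/card_gt0P; exists [ffun=> false].
pose e' := e / #|I|%:R; pose d' := dlt / #|I|%:R.
have e'0 : 0 < e' by rewrite divr_gt0.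
have d'0 : 0 < d' by rewrite divr_gt0.
pose u (b : I) : 'I_N -> int := fun l => t l - (b l : nat)%:Z.
have ev := iev_forall (s := enum I) (fun b _ => Minv_iev (u b) hG e'0 d'0).
have [B hB] := bound_ex t.
have [ms sz [h1 h2]] := iev_ex (iev_and ev (iev_ge N B)).
have := @far_sum _ _ _ P n I (fun b : I => \prod_l @bsgn R (b l))
  (fun b => Minv_partial Theta G (u b) ms) (fun b => Minv P Theta G (u b)) e' d' (ltW e'0).
move=> H; have {}H := H _ _ _ _.
have -> : e = #|I|%:R * e' by rewrite /e' mulrC divfK ?gt_eqF.
have -> : dlt = #|I|%:R * d' by rewrite /d' mulrC divfK ?gt_eqF.
rewrite far_sym; have -> : (fun w => E t *m Delta G t w) =
   (fun w => \sum_(b : I) (\prod_l @bsgn R (b l)) *: Minv_partial Theta G (u b) ms w).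
  apply: funext => w.
  rewrite -(@Delta_box_sum R _ N (fun l => - (nth 0%N ms l)%:Z) t (fun j => E j *m Delta G j w)) //.
  by move=> l; have := hB l; have := h2 l (ltn_ord l); lia.
have -> : Delta (Minv P Theta G) t =
   (fun w => \sum_(b : I) (\prod_l @bsgn R (b l)) *: Minv P Theta G (u b) w).
  by apply: funext => w; rewrite DeltaE.
apply: H => [b|b|b|b]; first by rewrite prod_bsgn_norm.
- exact: Minv_partial_meas.
- exact: mY.
- by apply: h1; rewrite mem_enum.
Qed.

Lemma ae_forall_seq (I : eqType) (s : seq I) (Q : I -> T -> Prop) :
  (forall i, {ae P, forall w, Q i w}) -> {ae P, forall w, forall i, i \in s -> Q i w}.
Proof.
move=> h; elim: s => [|i s IH]; first exact: aeW.
apply: filterS2 (h i) IH => w q1 q2 j; rewrite inE => /orP[/eqP->//|]; exact: q2.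
Qed.

Lemma Mtheta_Minv (G : @field R d T N n) t : GTheta0 P Theta G ->
  {ae P, forall w, Mtheta Theta (Minv P Theta G) t w = G t w}.
Proof.
move=> [hG h0].
pose c (b : {ffun 'I_N -> bool}) : 'I_N -> int := fun l => if b l then Mlo t l - 1 else Mhi t l.
(* The box is finite, so the almost sure identities hold for all its points at once. *)
have aeD := ae_forall_seq (enum {ffun 'I_N -> 'I_(\max_(l < N) `|Mhi t l - Mlo t l|%N).+1})
  (fun f => Delta_Minv (fun l => Mlo t l + (f l)%:Z) hG).
have ae0 : {ae P, forall w, forall b, b \in enum {ffun 'I_N -> bool} ->
   (exists l, c b l = 0) -> G (c b) w = 0}.
  apply: (@ae_forall_seq _ _ (fun b w => (exists l, c b l = 0) -> G (c b) w = 0)) => b.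
  have [ex|nex] := pselect (exists l, c b l = 0); last exact: aeW.
  by apply: filterS (h0 _ ex) => w h _.
apply: filterS2 aeD ae0 => w hD hZ.
rewrite MthetaE.
have -> : box_sum (Mlo t) (Mhi t) (fun j => E (negt j) *m Delta (Minv P Theta G) j w)
   = box_sum (Mlo t) (Mhi t) (fun j => Delta G j w).
  by apply: eq_bigr => f _; rewrite hD ?mem_enum // mulmxA exp_starK // mul1mx.
under [F in box_sum _ _ F]eq_fun => j do rewrite DeltaE.
rewrite box_sum_telescope => [|l]; last by rewrite /Mlo /Mhi; case: ifP; lia.
(* Whatever the sign of t_l, the two ends of coordinate l are 0 and t_l. The choice [b0] takes t_l
   everywhere, with a sign that cancels the prefactor; any other corner lies on an axis hyperplane,
   where G vanishes. *)
pose b0 : {ffun 'I_N -> bool} := [ffun l => t l < 0].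
have cb0 : c b0 = t.
  by apply: funext => l; rewrite /c /b0 ffunE /Mlo /Mhi; case: ltP; lia.
rewrite /tensor_sum (bigD1 b0) //= [X in _ + X]big1 ?addr0.
  rewrite -/(c b0) cb0 scalerA -big_split big1 ?scale1r // => l _.
  by rewrite /= /b0 ffunE /bsgn -expr2 sqrr_sign.
move=> b bb0; rewrite -/(c b) hZ ?mem_enum ?scaler0 //.
have [l bl] : exists l, b l != b0 l.
  apply/existsP; rewrite -negb_forall; apply: contra bb0 => /forallP h.
  by apply/eqP/ffunP => l; apply/eqP.
exists l; move: bl; rewrite /c /b0 ffunE /Mlo /Mhi; case: (b l); case: ltP => //; lia.
Qed.

End InverseLamperti.

Theorem mainTheorem8 (R : realType) (d : measure_display) (T : measurableType d)
    (P : probability T R) (N n : nat) (Theta : 'I_N -> 'M[R]_n) :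
  (forall j, symmetric_mx (Theta j)) ->
  (forall j, posdef_mx (Theta j)) ->
  (forall i j, Theta i *m Theta j = Theta j *m Theta i) ->
  [/\ (forall Y : @field R d T N n, self_similar P Theta Y -> GTheta0 P Theta (Mtheta Theta Y)),
      (forall G : @field R d T N n, GTheta P Theta G -> self_similar P Theta (Minv P Theta G)),
      (forall Y : @field R d T N n, self_similar P Theta Y ->
         forall t, {ae P, forall w, Minv P Theta (Mtheta Theta Y) t w = Y t w}) &
      (forall G : @field R d T N n, GTheta0 P Theta G ->
         forall t, {ae P, forall w, Mtheta Theta (Minv P Theta G) t w = G t w})].
Proof.
move=> symT posT comT; split.
- by move=> Y sY; exact: Mtheta_GTheta0.
- by move=> G hG; exact: Minv_self_similar.
- by move=> Y sY t; exact: Minv_Mtheta.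
- by move=> G hG t; exact: Mtheta_Minv.
Qed.
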